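(* Let $\Omega$ be a compact metric space and fix any $\mu\in\mathbb P(\Omega)$ with $\operatorname{supp}(\mu)=\Omega$. A kernel $K$ on $\Omega\times\Omega$ is positive definite if and only if there exists some $k\in L^2(\Omega\times\Omega,\mu\times\mu)$ such that for all $x,y\in\Omega$, $$K(x,y)=\int_\Omega k(x,z)\,k(z,y)\,d\mu(z).$$
   Context: A kernel on $\Omega\times\Omega$ is a continuous symmetric function $K:\Omega\times\Omega\to\mathbb R$, i.e. $K(x,y)=K(y,x)$ for all $x,y\in\Omega$. $\mathbb P(\Omega)$ is the set of Borel probability measures on $\Omega$, and $\operatorname{supp}(\mu)$ is the support of $\mu$. $K$ is positive definite if $I_K(\nu)=\int_\Omega\int_\Omega K(x,y)\,d\nu(x)\,d\nu(y)\ge0$ for every finite regular signed Borel measure $\nu$ on $\Omega$. $L^2(\Omega\times\Omega,\mu\times\mu)$ is the space of real-valued functions on $\Omega\times\Omega$ that are square-integrable with respect to the product measure $\mu\times\mu$.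
   Formalization: The function k is additionally required to be symmetric, k(x,y)=k(y,x); without this the ''if'' direction is false (two points of mass 1/2, k(a,b)=1, k(b,a)=-1, zero diagonal gives K=-1/2 on the diagonal and 0 off it, which is not positive definite). *)

(* Defs.v *)
From HB Require Import structures.
From mathcomp Require Import all_boot all_order all_algebra.
From mathcomp Require Import all_classical all_reals all_analysis.

Set Implicit Arguments.
Unset Strict Implicit.
Unset Printing Implicit Defensive.

Import Order.TTheory GRing.Theory Num.Theory.
Import numFieldNormedType.Exports.

Local Open Scope classical_set_scope.
Local Open Scope ring_scope.

(* A measurable type is pointed, so the Borel sigma-algebra is put on a pointed
   metric space. The base point is no restriction: a space carrying a
   probability measure is nonempty. *)
#[short(type="pointedMetricType")]
HB.structure Definition PointedMetric (R : numDomainType) :=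
  {T of Metric R T & Pointed T}.

Notation borelType T := (g_sigma_algebraType (@open T)).

Section kernels.
Context {R : realType} {Omega : pointedMetricType R}.

Definition is_symmetric (f : Omega * Omega -> R) : Prop :=
  forall x y, f (x, y) = f (y, x).

Definition is_kernel (K : Omega * Omega -> R) : Prop :=
  continuous K /\ is_symmetric K.

Definition measure_support (mu : {measure set (borelType Omega) -> \bar R}) :
    set Omega :=
  [set x | forall U : set Omega, open U -> U x -> (0 < mu U)%E].

Definition regular_measure (mu : {measure set (borelType Omega) -> \bar R}) :
    Prop :=
  forall A : set (borelType Omega), measurable A ->
    mu A = ereal_inf [set mu U | U in [set U : set Omega | open U /\ A `<=` U]]
    /\
    mu A = ereal_sup [set mu C | C in [set C : set Omega | compact C /\ C `<=` A]].

End kernels.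

(* The Jordan decomposition does not depend on the Hahn decomposition chosen. *)
Section signed_integral.
Context d (T : measurableType d) (R : realType).
Variable nu : {charge set T -> \bar R}.

Definition hahn_pos : set T := sval (cid (Hahn_decomposition nu)).

Definition hahn_neg : set T := sval (cid (svalP (cid (Hahn_decomposition nu)))).

Definition hahn_posneg : hahn_decomposition nu hahn_pos hahn_neg :=
  svalP (cid (svalP (cid (Hahn_decomposition nu)))).

Definition charge_integral (f : T -> R) : R :=
  \int[jordan_pos hahn_posneg]_x f x - \int[jordan_neg hahn_posneg]_x f x.

End signed_integral.

Section positive_definite.
Context {R : realType} {Omega : pointedMetricType R}.

(* Charges take finite values, so they are the finite signed Borel measures. *)
Definition regular_charge (nu : {charge set (borelType Omega) -> \bar R}) :
    Prop :=
  regular_measure (charge_variation (hahn_posneg nu)).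

(* The integrals are real-valued (Rintegral); nothing is lost as kernels are
   bounded on a compact space and nu is finite. *)
Definition energy (K : Omega * Omega -> R)
    (nu : {charge set (borelType Omega) -> \bar R}) : R :=
  charge_integral nu (fun y => charge_integral nu (fun x => K (x, y))).

Definition positive_definite (K : Omega * Omega -> R) : Prop :=
  forall nu : {charge set (borelType Omega) -> \bar R},
    regular_charge nu -> 0 <= energy K nu.

End positive_definite.

(* Main.v *)
Require Import Defs.
From mathcomp Require Import all_boot all_order all_algebra.
From mathcomp Require Import all_classical all_reals all_analysis measurable_realfun.
From mathcomp Require Import ring lra.

(** If K (x, y) is the integral of k (x, z) k (z, y), then a quadratic form
    of K at finitely many points is the integral of a square
    ([square_finitely_psd]), and a continuous kernel on a compact space is a
    uniform limit of kernels that are constant on the boxes of a finite Borel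
    partition, so that positivity at finitely many points passes to every signed
    measure ([bfun_quad_ge0]).

    Conversely, combinations of Dirac masses show that a positive definite K is
    positive at finitely many points, and the same approximation makes the
    integral operator T of K on L^2 (mu) positive. Scale K so that |K| <= 1;
    then 0 <= T <= 1, and k has to be a kernel of the square root of T. It is
    approximated by k_0 = 0, k_(n+1) = k_n + (K - k_n o k_n) / 2, where o is the
    composition of kernels. These are polynomials in T without constant term,
    hence continuous kernels. The inequalities between operators that control
    them are inequalities between polynomials on [0, 1] with an algebraic
    certificate: the difference lies in the cone generated by the squares, X and
    1 - X, on which the functional p |-> <f, p (T) f> is nonnegative. With the
    defect D_n = K - k_n o k_n they read 0 <= D_n <= K, n D_n <= 2 and
    (k_n - k_m) o (k_n - k_m) <= D_m + D_n.

    The representation of K is required at every point, and not only almost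
    everywhere, so these bounds have to reach the diagonal; this is where
    continuity and the full support of mu enter. A point mass is replaced by the
    average over a ball. Passing from the average over a tiny ball to the one
    over a ball of fixed radius s costs at most an oscillation of K, since
    D_n <= K as quadratic forms; at radius s, the bound n D_n <= 2 gives 2 / n
    divided by the mass of the ball, and these masses are bounded below. Hence
    D_n (x, x) tends to 0 uniformly in x ([defect_kernel_diag_cvg]), and so does
    D_n (x, y) by positivity.

    Finally, the integral of (k_n - k_m)^2 (x, .) is at most
    D_m (x, x) + D_n (x, x). Along a subsequence it decays geometrically, so that
    for every x the kernels k_n (x, .) converge almost everywhere and are
    dominated by a square integrable function. The pointwise limit is symmetric,
    and dominated convergence in the composition k_n o k_n gives the
    representation of K ([kernel_limit_square]). *)

Set Implicit Arguments.
Unset Strict Implicit.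
Unset Printing Implicit Defensive.

Import Order.TTheory GRing.Theory Num.Theory.
Import numFieldNormedType.Exports.

Local Open Scope classical_set_scope.
Local Open Scope ring_scope.

(** * Bounded measurable functions *)

Section bounded_measurable.
Context {R : realType}.

(** The common domain of all the functionals and operators below: these
    functions form an algebra, are integrable for every finite measure, on
    products as well, and integrating one variable out stays in the class. *)
Definition bmf d (T : measurableType d) (f : T -> R) : Prop :=
  measurable_fun [set: T] f /\ exists M, forall x, `|f x| <= M.

Section closure.
Context d (T : measurableType d).
Implicit Types f g : T -> R.

Lemma eq_bmf f g : f =1 g -> bmf f -> bmf g.
Proof. by move=> /funext ->. Qed.

Lemma bmf_cst (c : R) : bmf (fun _ : T => c).
Proof. by split; [exact: measurable_cst | exists `|c|]. Qed.

Lemma bmf_indic (A : set T) : measurable A -> bmf (\1_A : T -> R).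
Proof.
move=> mA; split; first exact: measurable_indic.
by exists 1 => x; rewrite indicE; case: (_ \in _); rewrite ?normr1 ?normr0.
Qed.

Lemma bmfD f g : bmf f -> bmf g -> bmf (fun x => f x + g x).
Proof.
move=> [mf [M fM]] [mg [N gN]]; split; first exact: measurable_funD.
by exists (M + N) => x; rewrite (le_trans (ler_normD _ _))// lerD.
Qed.

Lemma bmfM f g : bmf f -> bmf g -> bmf (fun x => f x * g x).
Proof.
move=> [mf [M fM]] [mg [N gN]]; split; first exact: measurable_funM.
by exists (M * N) => x; rewrite normrM ler_pM.
Qed.

Lemma bmfZ (c : R) f : bmf f -> bmf (fun x => c * f x).
Proof. by move=> bf; apply: bmfM => //; exact: bmf_cst. Qed.

Lemma bmfB f g : bmf f -> bmf g -> bmf (fun x => f x - g x).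
Proof.
move=> bf bg; apply: (@eq_bmf (fun x => f x + (-1) * g x)).
  by move=> x; rewrite mulN1r.
by apply: bmfD => //; exact: bmfZ.
Qed.

Lemma bmf_sum (I : Type) (s : seq I) (P : pred I) (f : I -> T -> R) :
  (forall i, bmf (f i)) -> bmf (fun x => \sum_(i <- s | P i) f i x).
Proof.
move=> bf; elim: s => [|i s IH].
  by apply: eq_bmf (bmf_cst 0) => x /=; rewrite big_nil.
apply: (@eq_bmf (fun x => (if P i then f i x else 0) + \sum_(i <- s | P i) f i x)).
  by move=> x /=; rewrite big_cons; case: ifP => // _; rewrite add0r.
by apply: bmfD => //; case: (P i) => //; exact: bmf_cst.
Qed.

Lemma bmf_comp d' (T' : measurableType d') f (h : T' -> T) :
  measurable_fun [set: T'] h -> bmf f -> bmf (fun x => f (h x)).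
Proof.
move=> mh [mf [M fM]]; split; first exact: (measurableT_comp mf mh).
by exists M.
Qed.

End closure.

Section integral.
Context d (T : measurableType d) (m : {finite_measure set T -> \bar R}).
Implicit Types f g : T -> R.

Lemma bmf_integrable f : bmf f -> m.-integrable [set: T] (EFin \o f).
Proof.
move=> [mf [M fM]]; apply: measurable_bounded_integrable => //.
  by rewrite -ge0_fin_numE// fin_num_measure.
by exists M; split; [exact: num_real|move=> N MN x _; exact: le_trans (ltW MN)].
Qed.

Lemma EFin_bRint f : bmf f -> (\int[m]_x f x)%:E = (\int[m]_x (f x)%:E)%E.
Proof.
move=> bf; rewrite fineK//; apply: integrable_fin_num => //.
exact: bmf_integrable.
Qed.

Lemma bRintD f g : bmf f -> bmf g ->
  \int[m]_x (f x + g x) = \int[m]_x f x + \int[m]_x g x.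
Proof. by move=> bf bg; rewrite RintegralD//; exact: bmf_integrable. Qed.

Lemma bRintB f g : bmf f -> bmf g ->
  \int[m]_x (f x - g x) = \int[m]_x f x - \int[m]_x g x.
Proof. by move=> bf bg; rewrite RintegralB//; exact: bmf_integrable. Qed.

Lemma bRintZ c f : bmf f -> \int[m]_x (c * f x) = c * \int[m]_x f x.
Proof. by move=> bf; rewrite RintegralZl//; exact: bmf_integrable. Qed.

Lemma bRint_le f g : bmf f -> bmf g -> (forall x, f x <= g x) ->
  \int[m]_x f x <= \int[m]_x g x.
Proof. by move=> bf bg fg; apply: le_Rintegral => //; exact: bmf_integrable. Qed.

Lemma bRint_norm f M : bmf f -> (forall x, `|f x| <= M) ->
  `|\int[m]_x f x| <= M * fine (m [set: T]).
Proof.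
move=> bf fM; apply: (le_trans (le_normr_Rintegral _ _)) => //.
  exact: bmf_integrable.
rewrite -Rintegral_cst//; apply: bRint_le => //; last exact: bmf_cst.
have [mf [N fN]] := bf; split; first exact: measurableT_comp.
by exists N => x; rewrite normr_id.
Qed.

End integral.

Section product_integrable.
Context d1 d2 (T1 : measurableType d1) (T2 : measurableType d2).
Variables (m1 : {finite_measure set T1 -> \bar R}).
Variables (m2 : {finite_measure set T2 -> \bar R}).
Implicit Types h : T1 * T2 -> R.

Lemma bmf_integrable2 h : bmf h ->
  (m1 \x m2)%E.-integrable [set: T1 * T2] (EFin \o h).
Proof.
move=> [mh [M hM]]; apply: measurable_bounded_integrable => //.
  rewrite -setXTT [ltLHS]product_measure1E//.
  by rewrite lte_mul_pinfty// ?fin_num_measure// -ge0_fin_numE// fin_num_measure.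
by exists M; split; [exact: num_real|move=> N MN x _; exact: le_trans (ltW MN)].
Qed.

End product_integrable.

Section fubini.
Context d1 d2 (T1 : measurableType d1) (T2 : measurableType d2).
Variables (m1 : {finite_measure set T1 -> \bar R}).
Variables (m2 : {finite_measure set T2 -> \bar R}).
Implicit Types h : T1 * T2 -> R.

Lemma bmf_sectl h y : bmf h -> bmf (fun x => h (x, y)).
Proof.
move=> bh; apply: (bmf_comp (h := fun x => (x, y))) bh.
exact: measurable_fun_pair.
Qed.

Lemma bmf_sectr h x : bmf h -> bmf (fun y => h (x, y)).
Proof.
move=> bh; apply: (bmf_comp (h := fun y => (x, y))) bh.
exact: measurable_fun_pair.
Qed.

Lemma bmf_intr h : bmf h -> bmf (fun x => \int[m2]_y h (x, y)).
Proof.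
move=> bh; split; last first.
  have [_ [M hM]] := bh; exists (M * fine (m2 [set: T2])) => x.
  by apply: bRint_norm => //; exact: bmf_sectr.
apply: (measurableT_comp (f := fine)); first exact: fine_measurable.
(* The first measure only serves to state integrability on the product. *)
pose delta : {finite_measure set T1 -> \bar R} := @dirac _ T1 point R.
exact: (measurable_fubini_F (bmf_integrable2 delta m2 bh)).
Qed.

Lemma bmf_intl h : bmf h -> bmf (fun y => \int[m1]_x h (x, y)).
Proof.
move=> bh; split; last first.
  have [_ [M hM]] := bh; exists (M * fine (m1 [set: T1])) => y.
  by apply: bRint_norm => //; exact: bmf_sectl.
apply: (measurableT_comp (f := fine)); first exact: fine_measurable.
pose delta : {finite_measure set T2 -> \bar R} := @dirac _ T2 point R.
exact: (measurable_fubini_G (bmf_integrable2 m1 delta bh)).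
Qed.

Lemma bRint_swap h : bmf h ->
  \int[m1]_x \int[m2]_y h (x, y) = \int[m2]_y \int[m1]_x h (x, y).
Proof.
move=> bh; apply/EFin_inj.
rewrite !EFin_bRint; [|exact: bmf_intl|exact: bmf_intr].
under eq_integral => x _ do rewrite (EFin_bRint m2 (bmf_sectr x bh)).
under [RHS]eq_integral => y _ do rewrite (EFin_bRint m1 (bmf_sectl y bh)).
exact: (Fubini (bmf_integrable2 m1 m2 bh)).
Qed.

End fubini.
End bounded_measurable.

(** * Continuous kernels on a compact metric space *)

Section uniform_limits.
Context {R : realType} d (T : measurableType d).

Lemma bmf_uniform_limit (f : T -> R) :
  (forall e, 0 < e -> exists2 g, bmf g & forall x, `|f x - g x| <= e) -> bmf f.
Proof.
move=> fa; have hp n : 0 < n.+1%:R^-1 :> R by rewrite invr_gt0.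
have [g gP] := choice (fun n : nat => (let: ex_intro2 g a b := fa _ (hp n) in
  ex_intro (fun g => bmf g /\ forall x, `|f x - g x| <= n.+1%:R^-1) g (conj a b))).
split.
- apply: (@measurable_fun_cvg _ _ _ _ g) => [n|x _]; first by have [[]] := gP n.
  apply/cvgrPdist_le => e e0; near=> n.
  apply: (le_trans ((gP n).2 x)).
  rewrite ltW//; near: n; exact: (near_infty_natSinv_lt (PosNum e0)).
- have [[_ [M gM]] fg] := gP 0%N; exists (1 + M) => x.
  rewrite -[f x](subrK (g 0%N x)) (le_trans (ler_normD _ _))// lerD//.
  by rewrite (le_trans (fg x))// invr1.
Unshelve. all: by end_near. Qed.

End uniform_limits.

Section compact_space.
Context {R : realType} {Omega : pointedMetricType R}.
Hypothesis cptOmega : compact [set: Omega].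
Notation B := (borelType Omega).

Lemma compact_uniform_continuity (K : Omega * Omega -> R) : continuous K ->
  forall e, 0 < e -> exists2 d, 0 < d &
    forall x x' y y', ball x d x' -> ball y d y' -> `|K (x, y) - K (x', y')| < e.
Proof.
move=> cK e e0.
have cpt2 : compact [set: Omega * Omega].
  by rewrite -setXTT; exact: compact_setX.
have : \forall d \near (0 : R)^'+, forall p, [set: Omega * Omega] p ->
    forall q, ball p d q -> `|K p - K q| < e.
  move/compact_near_coveringP : cpt2 => /(_ _ _
    (fun d p => forall q, ball p d q -> `|K p - K q| < e)); apply => p _.
  have e20 : 0 < e / 2 by rewrite divr_gt0.
  have /cvgrPdist_lt/(_ _ e20)/nbhs_ballP[d /= d0 dP] := cK p.
  have d20 : 0 < d / 2 by rewrite divr_gt0.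
  near=> p' d' => q p'q.
  have pp' : ball p (d / 2) p' by near: p'; exact: nbhsx_ballx.
  have d'd : d' <= d / 2 by near: d'; exact: nbhs_right_le.
  have pq : ball p d q.
    by rewrite [d]splitr; apply: ball_triangle pp' _; exact: le_ball p'q.
  have pp : ball p d p'.
    by apply: le_ball pp'; lra.
  have h1 := dP _ pp; have h2 := dP _ pq.
  rewrite (splitr e) (le_lt_trans (ler_distD (K p) _ _))// ltrD//.
  by rewrite distrC.
move=> H.
have [d [d0 dP]] : exists d, 0 < d /\ forall p, [set: Omega * Omega] p ->
    forall q, ball p d q -> `|K p - K q| < e.
  near (0 : R)^'+ => d; exists d; split => //.
  by near: d; exact: H.
by exists d => // x x' y y' xx' yy'; apply: dP => //; split.
Unshelve. all: by end_near. Qed.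

Lemma compact_kernel_bounded (K : Omega * Omega -> R) : continuous K ->
  exists2 M, 0 < M & forall p, `|K p| <= M.
Proof.
move=> cK; have cpt2 : compact [set: Omega * Omega].
  by rewrite -setXTT; exact: compact_setX.
have : compact (K @` [set: Omega * Omega]).
  by apply: continuous_compact => //; exact: continuous_subspaceT.
move=> /compact_bounded[M [_ MP]]; exists (`|M| + 1); first by rewrite ltr_wpDl.
move=> p; apply: (MP (`|M| + 1)); last by exists p.
by rewrite (le_lt_trans (ler_norm M))// ltrDl.
Qed.

Lemma borel_open (U : set Omega) : open U -> measurable (U : set B).
Proof. by move=> oU; exact: sub_sigma_algebra. Qed.

(** Interiors of balls are open by definition, which serves both for the cover
    and for the measurability of the cells cut out by the net. *)
Lemma finite_net d : 0 < d ->
  exists s : seq Omega, forall z, has (fun c => `[< (ball c d)^° z >]) s.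
Proof.
move=> d0; move: cptOmega; rewrite compact_cover => cc.
have [||D _ DP] := cc _ [set: Omega] (fun c => (ball c d)^°).
- by move=> c _; exact: open_interior.
- by move=> z _; exists z => //; exact: nbhsx_ballx.
exists (finmap.enum_fset D) => z; have [c /= cD zc] := DP z I.
by apply/hasP; exists c => //; exact/asboolP.
Qed.

(** Sorting the points by the first centre of a net that is close to them gives
    a Borel partition; K varies little on the product of two of its cells. *)
Lemma kernel_simple_approx (K : Omega * Omega -> R) : continuous K ->
  forall e, 0 < e -> exists n (x : 'I_n -> Omega) (A : 'I_n -> set B),
    (forall i, measurable (A i)) /\
    forall u v, `|K (u, v) -
      \sum_i \sum_j (\1_(A i) u * \1_(A j) v) * K (x i, x j)| <= e.
Proof.
move=> cK e e0; have [d d0 dP] := compact_uniform_continuity cK e0.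
have [s sP] := finite_net d0.
pose near_ (z : Omega) : pred Omega := fun c => `[< (ball c d)^° z >].
exists (size s), (fun i => nth point s i), (fun i => [set z | find (near_ z) s = i]).
split=> [i|u v].
  (* The cells are Borel by induction on the list of centres. *)
  move: (nat_of_ord i) => {i} n; elim: s n {sP} => [|c s IH] n /=.
    case: n => [|n].
      by rewrite [X in measurable X](_ : _ = setT)//; apply/seteqP; split.
    by rewrite [X in measurable X](_ : _ = set0)//; apply/seteqP; split.
  have mc : measurable ((ball c d)^° : set B).
    by apply: borel_open; exact: open_interior.
  case: n => [|n].
    rewrite [X in measurable X](_ : _ = (ball c d)^°)//; apply/seteqP; split => z /=.
      by rewrite /near_; case: asboolP.
    by rewrite /near_; case: asboolP.
  rewrite [X in measurable X](_ : _ =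
    ~` (ball c d)^° `&` [set z | find (near_ z) s = n]); last first.
    apply/seteqP; split => z /=; rewrite /near_; case: asboolP => zc //=.
    - by move=> [] ?; split.
    - by case.
    - by case=> _ ->.
  by apply: measurableI => //; exact: measurableC.
(* Exactly one cell contains z, so that a sum over the cells has one term. *)
have ind z : exists i : 'I_(size s), ball (nth point s i) d z /\
    forall g : 'I_(size s) -> R,
    \sum_(j < size s) (\1_[set z | find (near_ z) s = j :> nat] z * g j) = g i.
  have fs : (find (near_ z) s < size s)%N by rewrite -has_find; exact: sP.
  exists (Ordinal fs); split => /=.
    by have /asboolP/interior_subset := nth_find point (sP z).
  move=> g; rewrite (bigD1 (Ordinal fs))//= big1 ?addr0 => [|i].
    by rewrite indicE mem_set ?mul1r.
  move=> ine; rewrite indicE memNset ?mul0r//= => fi.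
  by move/eqP: ine; apply; exact/val_inj.
have [i [iu Pi]] := ind u; have [j [jv Pj]] := ind v.
rewrite (_ : \sum_i \sum_j _ = K (nth point s i, nth point s j)).
  by rewrite distrC ltW//; exact: dP.
rewrite -(Pi (fun i => K (nth point s i, nth point s j))); apply: eq_bigr => i' _.
rewrite -(Pj (fun j => K (nth point s i', nth point s j))) mulr_sumr.
by apply: eq_bigr => j' _; rewrite mulrA.
Qed.

(** Continuity on the product gives measurability for the product of the Borel
    sigma-algebras because K is a uniform limit of kernels that are measurable
    for it. *)
Lemma continuous_bmf2 (K : Omega * Omega -> R) : continuous K ->
  bmf (K : B * B -> R).
Proof.
move=> cK; apply: bmf_uniform_limit => e e0.
have [n [x [A [mA AP]]]] := kernel_simple_approx cK e0.
exists (fun p : B * B =>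
  \sum_i \sum_j (\1_(A i) p.1 * \1_(A j) p.2) * K (x i, x j)).
  do 2 (apply: bmf_sum => ?); apply: bmfM; last exact: bmf_cst.
  by apply: bmfM; [apply: (bmf_comp (h := fst))|apply: (bmf_comp (h := snd))] => //;
    exact: bmf_indic.
by case=> u v; exact: AP.
Qed.

End compact_space.

(** * Finite and continuous forms of positivity *)

Section bounded_functionals.
Context {R : realType} {Omega : pointedMetricType R}.
Hypothesis cptOmega : compact [set: Omega].
Notation B := (borelType Omega).

Definition finitely_psd (K : Omega * Omega -> R) : Prop :=
  forall n (x : 'I_n -> Omega) (c : 'I_n -> R),
    0 <= \sum_i \sum_j c i * c j * K (x i, x j).

(** The functionals of interest are integration against a charge, against a
    density with respect to mu, and finite sums of point evaluations. *)
Record bounded_functional (C : R) (S : (B -> R) -> R) : Prop := {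
  bfun_cst_gt0 : 0 < C ;
  bfunD : forall f g, bmf f -> bmf g -> S (fun x => f x + g x) = S f + S g ;
  bfunZ : forall c f, bmf f -> S (fun x => c * f x) = c * S f ;
  bfun_bounded : forall f M, bmf f -> (forall x, `|f x| <= M) ->
    `|S f| <= C * M }.

Lemma bounded_functional_le C C' S : C <= C' ->
  bounded_functional C S -> bounded_functional C' S.
Proof.
move=> CC' [C0 SD SZ SC]; split => //; first exact: lt_le_trans CC'.
move=> f M bf fM; rewrite (le_trans (SC f M bf fM))// ler_wpM2r//.
exact: le_trans (fM point).
Qed.

Section theory.
Variables (C : R) (S : (B -> R) -> R) (bS : bounded_functional C S).

Lemma bfunB f g : bmf f -> bmf g -> S (fun x => f x - g x) = S f - S g.
Proof.
move=> bf bg; rewrite -mulN1r -(bfunZ bS)// -(bfunD bS)//; last exact: bmfZ.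
by congr S; apply/funext => x; rewrite mulN1r.
Qed.

Lemma bfun_sum n (f : 'I_n -> B -> R) : (forall i, bmf (f i)) ->
  S (fun x => \sum_i f i x) = \sum_i S (f i).
Proof.
move=> bf; have S0 : S (fun=> 0) = 0.
  rewrite -[RHS](mul0r (S (fun=> 0))) -(bfunZ bS); last exact: bmf_cst.
  by congr S; apply/funext => x; rewrite mul0r.
elim: n f bf => [|n IH] f bf.
  by rewrite big_ord0 -S0; congr S; apply/funext => x; rewrite big_ord0.
rewrite big_ord_recl -IH// -(bfunD bS)//; last exact: bmf_sum.
by congr S; apply/funext => x; rewrite big_ord_recl.
Qed.

Section simple_kernel.
Variables (n : nat) (a : 'I_n -> 'I_n -> R) (A : 'I_n -> set B).
Hypothesis mA : forall i, measurable (A i).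

Definition simple_kernel (u v : B) : R :=
  \sum_i \sum_j (\1_(A i) u * \1_(A j) v) * a i j.

Let bA i : bmf (\1_(A i) : B -> R). Proof. exact: bmf_indic. Qed.

Lemma bmf_simple_kernel v : bmf (simple_kernel ^~ v).
Proof.
apply: bmf_sum => i; apply: bmf_sum => j.
by apply: bmfM (bmf_cst _ _); apply: bmfM (bmf_cst _ _).
Qed.

Lemma bfun_simple_kernel v : S (simple_kernel ^~ v) =
  \sum_i \sum_j (S \1_(A i) * a i j) * \1_(A j) v.
Proof.
rewrite bfun_sum => [|i]; last first.
  by apply: bmf_sum => j; apply: bmfM (bmf_cst _ _); apply: bmfM (bmf_cst _ _).
apply: eq_bigr => i _; rewrite bfun_sum => [|j]; last first.
  by apply: bmfM (bmf_cst _ _); apply: bmfM (bmf_cst _ _).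
apply: eq_bigr => j _; rewrite [LHS](_ : _ = S (fun u =>
  (a i j * \1_(A j) v) * \1_(A i) u)).
  by rewrite (bfunZ bS)//; ring.
by congr S; apply/funext => u; ring.
Qed.

Lemma bmf_bfun_simple_kernel : bmf (fun v => S (simple_kernel ^~ v)).
Proof.
rewrite (funext bfun_simple_kernel).
by do 2 (apply: bmf_sum => ?); apply: bmfZ.
Qed.

Lemma bfun_quad_simple_kernel : S (fun v => S (simple_kernel ^~ v)) =
  \sum_i \sum_j S \1_(A i) * S \1_(A j) * a i j.
Proof.
rewrite (funext bfun_simple_kernel).
rewrite bfun_sum => [|i]; last by apply: bmf_sum => j; exact: bmfZ.
apply: eq_bigr => i _; rewrite bfun_sum => [|j]; last exact: bmfZ.
by apply: eq_bigr => j _; rewrite (bfunZ bS)//; ring.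
Qed.

End simple_kernel.

Lemma bmf_bfun (K : Omega * Omega -> R) : continuous K ->
  bmf (fun y : B => S (fun x => K (x, y))).
Proof.
move=> cK; have C0 := bfun_cst_gt0 bS; apply: bmf_uniform_limit => e e0.
have [n [x [A [mA AP]]]] := kernel_simple_approx cptOmega cK (divr_gt0 e0 C0).
have bK' := bmf_simple_kernel (fun i j => K (x i, x j)) mA.
exists (fun v => S (simple_kernel (fun i j => K (x i, x j)) A ^~ v)).
  exact: bmf_bfun_simple_kernel.
move=> v.
have bKv := bmf_sectl (h := K : B * B -> R) v (continuous_bmf2 cptOmega cK).
rewrite -bfunB// (_ : e = C * (e / C)); last by rewrite mulrC divfK// gt_eqF.
by apply: (bfun_bounded bS) => [|u]; [exact: bmfB|exact: AP].
Qed.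

End theory.

(** The partition depends on the functional only through its bound, so that two
    functionals can be compared on the same partition. *)
Lemma bfun_quad_approx (K : Omega * Omega -> R) C e :
  continuous K -> 0 < C -> 0 < e ->
  exists n (x : 'I_n -> Omega) (A : 'I_n -> set B), (forall i, measurable (A i)) /\
  forall S, bounded_functional C S ->
    `|S (fun y => S (fun x => K (x, y))) -
      \sum_i \sum_j S \1_(A i) * S \1_(A j) * K (x i, x j)| <= e.
Proof.
move=> cK C0 e0; have CC0 : 0 < C * C by rewrite mulr_gt0.
have [n [x [A [mA AP]]]] := kernel_simple_approx cptOmega cK (divr_gt0 e0 CC0).
exists n, x, A; split=> // S bS.
rewrite -(bfun_quad_simple_kernel bS (fun i j => K (x i, x j)) mA).
have bK' := bmf_simple_kernel (fun i j => K (x i, x j)) mA.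
have bSK' := bmf_bfun_simple_kernel bS (fun i j => K (x i, x j)) mA.
have bSK := bmf_bfun bS cK.
rewrite -(bfunB bS)// (_ : e = C * (C * (e / (C * C)))); last first.
  by field; rewrite gt_eqF.
apply: (bfun_bounded bS) => [|v]; first exact: bmfB.
have bKv := bmf_sectl (h := K : B * B -> R) v (continuous_bmf2 cptOmega cK).
rewrite -(bfunB bS)//.
by apply: (bfun_bounded bS) => [|u]; [exact: bmfB|exact: AP].
Qed.

(** The form of K on a simple approximation is one of its finite forms, at the
    points of the partition and with the weights S \1_A. *)
Lemma bfun_quad_ge0 C S (K : Omega * Omega -> R) : bounded_functional C S ->
  continuous K -> finitely_psd K -> 0 <= S (fun y => S (fun x => K (x, y))).
Proof.
move=> bS cK psdK; apply/ler_addgt0Pl => e e0.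
have [n [x [A [mA /(_ S bS)]]]] := bfun_quad_approx cK (bfun_cst_gt0 bS) e0.
have := psdK n x (fun i => S \1_(A i)).
by rewrite ler_norml => ? /andP[]; lra.
Qed.

Lemma bfun_quad_eq C C' S S' (K : Omega * Omega -> R) :
  bounded_functional C S -> bounded_functional C' S' ->
  (forall A : set B, measurable A -> S \1_A = S' \1_A) -> continuous K ->
  S (fun y => S (fun x => K (x, y))) = S' (fun y => S' (fun x => K (x, y))).
Proof.
move=> bS bS' SS' cK; apply/eqP; rewrite -subr_eq0 -normr_le0.
apply/ler_addgt0Pl => e e0; rewrite addr0.
have C0 := bfun_cst_gt0 bS; have C0' := bfun_cst_gt0 bS'.
have [||n [x [A [mA AP]]]] := @bfun_quad_approx K (C + C') (e / 2) cK.
- exact: addr_gt0.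
- exact: divr_gt0.
have h1 := AP _ (bounded_functional_le (ltac:(lra) : C <= C + C') bS).
have h2 := AP _ (bounded_functional_le (ltac:(lra) : C' <= C + C') bS').
move: h1 h2; under eq_bigr do under eq_bigr do rewrite !SS'//.
by rewrite !ler_norml => /andP[? ?] /andP[? ?]; apply/andP; split; lra.
Qed.

End bounded_functionals.

(** * Charges as functionals *)

Section charge_functional.
Context {R : realType} {Omega : pointedMetricType R}.
Notation B := (borelType Omega).

Lemma charge_integral_bounded (nu : {charge set B -> \bar R}) :
  exists C, bounded_functional C (charge_integral nu).
Proof.
pose mp : {finite_measure set B -> \bar R} := jordan_pos (hahn_posneg nu).
pose mn : {finite_measure set B -> \bar R} := jordan_neg (hahn_posneg nu).
exists (fine (mp setT) + fine (mn setT) + 1); split.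
- by rewrite ltr_wpDl// addr_ge0// fine_ge0.
- move=> f g bf bg; rewrite /charge_integral.
  by rewrite (bRintD mp)// (bRintD mn)//; ring.
- move=> c f bf; rewrite /charge_integral.
  by rewrite (bRintZ mp)// (bRintZ mn)//; ring.
- move=> f M bf fM; rewrite /charge_integral (le_trans (ler_normB _ _))//.
  rewrite (le_trans (lerD (bRint_norm mp bf fM) (bRint_norm mn bf fM)))//.
  have M0 : 0 <= M by exact: le_trans (fM point).
  by rewrite -subr_ge0 (_ : _ - _ = M)//; ring.
Qed.

Lemma charge_integral_indic (nu : {charge set B -> \bar R}) (A : set B) :
  measurable A -> charge_integral nu \1_A = fine (nu A).
Proof.
move=> mA; rewrite /charge_integral.
pose mp : {finite_measure set B -> \bar R} := jordan_pos (hahn_posneg nu).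
pose mn : {finite_measure set B -> \bar R} := jordan_neg (hahn_posneg nu).
rewrite (jordan_decomp (hahn_posneg nu) mA) /cadd /= /cscale /=.
rewrite /Rintegral !integral_indic// !setIT.
rewrite EFinN mulN1e fineD ?fineN//; last 2 first.
- exact: (fin_num_measure mp).
- by rewrite fin_numN; exact: (fin_num_measure mn).
Qed.

Lemma bounded_functional_sum n (x : 'I_n -> B) (c : 'I_n -> R) :
  exists C, bounded_functional C (fun f => \sum_i c i * f (x i)).
Proof.
exists (\sum_i `|c i| + 1); split.
- by rewrite ltr_wpDl// sumr_ge0.
- move=> f g _ _; rewrite -big_split; apply: eq_bigr => i _.
  by rewrite mulrDr.
- move=> a f _; rewrite mulr_sumr; apply: eq_bigr => i _.
  by rewrite mulrCA.
- move=> f M _ fM; have M0 : 0 <= M by exact: le_trans (fM point).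
  rewrite mulrDl mul1r ler_wpDr// (le_trans (ler_norm_sum _ _ _))//.
  by rewrite mulr_suml ler_sum// => i _; rewrite normrM ler_wpM2l.
Qed.

Lemma dirac_charge n (x : 'I_n -> B) (c : 'I_n -> R) :
  exists nu : {charge set B -> \bar R}, forall A : set B, measurable A ->
    nu A = (\sum_i c i * \1_A (x i))%:E.
Proof.
elim: n x c => [|n IH] x c.
  by exists czero => A mA; rewrite big_ord0.
have [nu nuE] := IH (fun i => x (lift ord0 i)) (fun i => c (lift ord0 i)).
pose delta : {finite_measure set B -> \bar R} := @dirac _ B (x ord0) R.
exists (cadd (cscale (c ord0) (charge_of_finite_measure delta)) nu) => A mA.
transitivity ((c ord0)%:E * \d_(x ord0) A + nu A)%E => //.
by rewrite nuE// diracE big_ord_recl indicE EFinD EFinM.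
Qed.

(** Let F be the finite carrier. A Borel set A has the same variation as
    A `&` F, which is compact, and as the open complement of F `\` A. *)
Lemma finitely_supported_regular (nu : {charge set B -> \bar R}) (F : set Omega) :
  finite_set F ->
  (forall A : set B, measurable A -> A `&` F = set0 -> nu A = 0%E) ->
  regular_charge nu.
Proof.
move=> finF nu0.
have closed_fin (C : set Omega) : finite_set C -> closed C.
  move=> fC; apply: accessible_finite_set_closed.1 => //.
  exact/hausdorff_accessible/metric_hausdorff.
have mclosed (C : set Omega) : closed C -> measurable (C : set B).
  move=> cC; rewrite -[C]setCK; apply: measurableC; apply: borel_open.
  exact: closed_openC.
pose V : {measure set B -> \bar R} := charge_variation (hahn_posneg nu).
have [[mP _] [mN _] _ _] := hahn_posneg nu.
have V0 (A : set B) : measurable A -> A `&` F = set0 -> V A = 0%E.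
  move=> mA AF.
  have VE : V A = (jordan_pos (hahn_posneg nu) A +
    jordan_neg (hahn_posneg nu) A)%E by [].
  rewrite VE jordan_posE jordan_negE cjordan_posE cjordan_negE /crestr0.
  rewrite !mem_set// /crestr !nu0 ?oppe0 ?adde0//; try exact: measurableI.
  - by rewrite setIAC AF set0I.
  - by rewrite setIAC AF set0I.
have mF : measurable (F : set B) by apply: mclosed; exact: closed_fin.
have VF (A : set B) : measurable A -> V A = V (A `&` F).
  move=> mA; have mAF : measurable (A `\` F) by exact: measurableD.
  rewrite -[in LHS](setUIDK A F) measureU//; last 2 first.
  - exact: measurableI.
  - by rewrite setDE setIACA setICr !setI0.
  by rewrite [X in (_ + X)%E]V0 ?adde0// setDE -setIA setICl setI0.
move=> A mA; split; apply/eqP; rewrite eq_le; apply/andP; split.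
- apply: le_ereal_inf_tmp => _ [U [oU AU] <-].
  by apply: le_measure; rewrite ?inE//; exact: borel_open.
- have oU : open (~` (F `\` A)).
    by apply: closed_openC; apply: closed_fin; exact: finite_setD.
  apply: ereal_inf_lbound; exists (~` (F `\` A)).
    by split => // z Az [].
  have E : ~` (F `\` A) `&` F = A `&` F.
    apply/seteqP; split => z [h Fz]; split => //; last by case.
    by apply: contrapT => nAz; exact: h.
  transitivity (V (A `&` F)); last by rewrite -VF.
  by rewrite -E; apply: VF; exact: borel_open.
- apply: ereal_sup_ubound; exists (A `&` F); last exact/esym/VF.
  by split => //; apply: finite_compact; exact: finite_setIr.
- apply: ge_ereal_sup => _ [C [cC CA] <-].
  apply: le_measure; rewrite ?inE//; apply: mclosed.
  by apply: compact_closed => //; exact: metric_hausdorff.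
Qed.

(** The energy of a combination of Dirac masses is a finite quadratic form. The
    Jordan decomposition of the charge need not be computed: integration
    against the charge and the sum of evaluations agree on indicators. *)
Lemma positive_definite_finitely_psd (K : Omega * Omega -> R) :
  compact [set: Omega] -> continuous K -> positive_definite K -> finitely_psd K.
Proof.
move=> cptOmega cK pdK n x c.
have [nu nuE] := dirac_charge x c.
have [C bS] := charge_integral_bounded nu.
have [C' bS'] := bounded_functional_sum x c.
have := pdK nu; rewrite /energy (bfun_quad_eq cptOmega bS bS' _ cK); last first.
  by move=> A mA; rewrite charge_integral_indic// nuE.
have -> : \sum_i c i * (\sum_j c j * K (x j, x i)) =
    \sum_i \sum_j c i * c j * K (x i, x j).
  rewrite exchange_big /=; under eq_bigr do rewrite mulr_sumr.
  by apply: eq_bigr => i _; apply: eq_bigr => j _; ring.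
apply; apply: (@finitely_supported_regular _ [set` [seq x i | i : 'I_n]]).
  exact: finite_seq.
move=> A mA AF; rewrite nuE// big1// => i _.
rewrite indicE memNset ?mulr0// => Axi.
have : (A `&` [set` [seq x i | i : 'I_n]]) (x i).
  by split => //=; apply/mapP; exists i; rewrite ?mem_enum.
by rewrite AF.
Qed.

Lemma finitely_psd_positive_definite (K : Omega * Omega -> R) :
  compact [set: Omega] -> continuous K -> finitely_psd K -> positive_definite K.
Proof.
move=> cptOmega cK psdK nu _; have [C bS] := charge_integral_bounded nu.
exact: bfun_quad_ge0 bS cK psdK.
Qed.

End charge_functional.

(** * A square is positive definite *)

Section square_kernel.
Context {R : realType} {Omega : pointedMetricType R}.
Notation B := (borelType Omega).
Variables (mu : {measure set B -> \bar R}) (K : Omega * Omega -> R) (k : B * B -> R).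
Hypotheses (mk : measurable_fun [set: B * B] k) (symk : is_symmetric k).
Hypothesis KE :
  forall x y, (K (x, y))%:E = (\int[mu]_z (k (x, z) * k (z, y))%:E)%E.

(** On the diagonal, the representation says that the sections of k are square
    integrable. *)
Lemma square_kernel_integrable u v :
  mu.-integrable [set: B] (fun z => (k (u, z) * k (z, v))%:E).
Proof.
have mkx w : measurable_fun [set: B] (fun z => k (w, z)).
  exact: (measurableT_comp mk
    (measurable_fun_pair (measurable_cst w) (@measurable_id _ B setT))).
have iksq w : mu.-integrable [set: B] (fun z => (k (w, z) ^+ 2)%:E).
  apply/integrableP; split.
    by apply/measurable_EFinP; exact: measurable_funX.
  under eq_integral do rewrite /= ger0_norm ?sqr_ge0// expr2 [X in _ * X]symk.
  by rewrite -KE ltry.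
apply: (le_integrable _ _ _ (integrableD _ (iksq u) (iksq v))) => //.
  apply/measurable_EFinP; apply: measurable_funM => //.
  by rewrite (_ : (fun z => k (z, v)) = fun z => k (v, z))//; apply/funext => z.
move=> z _; rewrite /= lee_fin [X in _ <= X]ger0_norm ?addr_ge0 ?sqr_ge0//.
rewrite (symk z v) normrM.
have := sqr_ge0 (`|k (u, z)| - `|k (v, z)|).
rewrite -(real_normK (num_real (k (u, z)))) -(real_normK (num_real (k (v, z)))).
move: `|k (u, z)| `|k (v, z)| (normr_ge0 (k (u, z))) (normr_ge0 (k (v, z))).
by move=> a b a0 b0; nra.
Qed.

Lemma square_finitely_psd : finitely_psd K.
Proof.
move=> n x c.
have ick i j : mu.-integrable [set: B]
    (fun z => (c i * c j)%:E * (k (x i, z) * k (z, x j))%:E)%E.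
  by apply: integrableZl => //; exact: square_kernel_integrable.
rewrite -lee_fin (_ : (\sum_i _)%:E =
    (\int[mu]_z ((\sum_i c i * k (x i, z)) ^+ 2)%:E)%E).
  by apply: integral_ge0 => z _; rewrite lee_fin sqr_ge0.
transitivity (\int[mu]_z \sum_i \sum_j
    (c i * c j)%:E * (k (x i, z) * k (z, x j))%:E)%E; last first.
  apply: eq_integral => z _; rewrite expr2 mulr_suml -sumEFin.
  apply: eq_bigr => i _; rewrite mulr_sumr -sumEFin; apply: eq_bigr => j _.
  by rewrite -EFinM (symk z); congr EFin; ring.
rewrite integral_sum//; last by move=> i; exact: integrable_sum.
rewrite -sumEFin; apply: eq_bigr => i _.
rewrite integral_sum// -sumEFin; apply: eq_bigr => j _.
by rewrite integralZl// -?KE -?EFinM//; exact: square_kernel_integrable.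
Qed.

End square_kernel.

(** * Polynomials that are positive on the unit interval *)

Section positive_polynomials.
Context {R : realType}.
Implicit Types (p q r : {poly R}) (phi : {poly R} -> R).

(** A functional of the form p |-> <f, p(T) f>, where T is a self-adjoint
    operator between 0 and 1, is the model of these. *)
Record interval_positive phi : Prop := IntervalPositive {
  iposD : forall p q, phi (p + q) = phi p + phi q ;
  iposZ : forall c p, phi (c *: p) = c * phi p ;
  ipos_sq : forall q, 0 <= phi (q ^+ 2) ;
  ipos_Xsq : forall q, 0 <= phi ('X * q ^+ 2) ;
  ipos_1Xsq : forall q, 0 <= phi ((1 - 'X) * q ^+ 2) }.

(** The cone is given by duality, as the polynomials on which all these
    functionals are nonnegative; closure under products then says that
    p |-> phi (p q) is such a functional when phi is and q is in the cone. *)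
Definition poly_cone p : Prop := forall phi, interval_positive phi -> 0 <= phi p.

Lemma cone_sq q : poly_cone (q ^+ 2).
Proof. by move=> phi /ipos_sq. Qed.

Lemma cone_X : poly_cone 'X.
Proof. by move=> phi /ipos_Xsq/(_ 1); rewrite expr1n mulr1. Qed.

Lemma cone_1X : poly_cone (1 - 'X).
Proof. by move=> phi /ipos_1Xsq/(_ 1); rewrite expr1n mulr1. Qed.

Lemma coneD p q : poly_cone p -> poly_cone q -> poly_cone (p + q).
Proof.
by move=> cp cq phi pos; rewrite (iposD pos) addr_ge0//; [exact: cp|exact: cq].
Qed.

Lemma coneZ c p : 0 <= c -> poly_cone p -> poly_cone (c *: p).
Proof. by move=> c0 cp phi pos; rewrite (iposZ pos) mulr_ge0//; exact: cp. Qed.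

Lemma cone1 : poly_cone 1.
Proof. by rewrite -(expr1n _ 2); exact: cone_sq. Qed.

Lemma cone0 : poly_cone 0.
Proof. by rewrite -(scale0r 1); apply: coneZ => //; exact: cone1. Qed.

(** The only product of generators that is not visibly a sum of generators times
    squares is X (1 - X) = (1 - X) X^2 + X (1 - X)^2. *)
Lemma ipos_mul g phi : g = 1 \/ g = 'X \/ g = 1 - 'X -> interval_positive phi ->
  forall r, interval_positive (fun p => phi (g * r ^+ 2 * p)).
Proof.
move=> gE pos r.
have X1X q : 0 <= phi ('X * (1 - 'X) * q ^+ 2).
  rewrite (_ : _ * _ = (1 - 'X) * ('X * q) ^+ 2 +
    'X * ((1 - 'X) * q) ^+ 2); last by ring.
  by rewrite (iposD pos) addr_ge0//; [exact: (ipos_1Xsq pos)|exact: (ipos_Xsq pos)].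
have phiE a b : a = b -> 0 <= phi b -> 0 <= phi a by move=> ->.
split.
- by move=> p q; rewrite mulrDr (iposD pos).
- by move=> c p; rewrite -scalerAr (iposZ pos).
- move=> q; rewrite -mulrA -exprMn; case: gE => [->|[->|->]].
  + by rewrite mul1r; exact: (ipos_sq pos).
  + exact: (ipos_Xsq pos).
  + exact: (ipos_1Xsq pos).
- move=> q; case: gE => [->|[->|->]].
  + by apply: (phiE _ ('X * (r * q) ^+ 2)); [ring|exact: (ipos_Xsq pos)].
  + by apply: (phiE _ (('X * r * q) ^+ 2)); [ring|exact: (ipos_sq pos)].
  + by apply: (phiE _ ('X * (1 - 'X) * (r * q) ^+ 2)); [ring|exact: X1X].
- move=> q; case: gE => [->|[->|->]].
  + by apply: (phiE _ ((1 - 'X) * (r * q) ^+ 2)); [ring|exact: (ipos_1Xsq pos)].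
  + by apply: (phiE _ ('X * (1 - 'X) * (r * q) ^+ 2)); [ring|exact: X1X].
  + by apply: (phiE _ (((1 - 'X) * r * q) ^+ 2)); [ring|exact: (ipos_sq pos)].
Qed.

Lemma coneM p q : poly_cone p -> poly_cone q -> poly_cone (p * q).
Proof.
move=> cp cq phi pos.
have key g r : g = 1 \/ g = 'X \/ g = 1 - 'X -> 0 <= phi (g * r ^+ 2 * q).
  by move=> gE; exact: (cq _ (ipos_mul gE pos r)).
apply: (cp (fun p => phi (p * q))); split.
- by move=> p1 p2; rewrite mulrDl (iposD pos).
- by move=> c p1; rewrite -scalerAl (iposZ pos).
- by move=> r; rewrite -[r ^+ 2]mul1r; apply: key; left.
- by move=> r; apply: key; right; left.
- by move=> r; apply: key; right; right.
Qed.

(** The classical iteration increasing to the square root on the unit interval. *)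
Fixpoint sqrt_poly (n : nat) : {poly R} :=
  if n is m.+1 then sqrt_poly m + 2^-1 *: ('X - sqrt_poly m ^+ 2) else 0.

Definition sqrt_defect n : {poly R} := 'X - sqrt_poly n ^+ 2.

Let h : {poly R} := (2^-1)%:P.
Let hh : 1 - (h + h) = 0 :> {poly R}.
Proof.
by rewrite -polyCD -polyC1 -polyCB -(_ : 0%:P = 0 :> {poly R})//; congr polyC; lra.
Qed.

(* With h kept formal, identities relying on h + h = 1 hold up to a multiple of
   1 - (h + h), with cofactor D. *)
Let half_eq D p q : p = q + D * (1 - (h + h)) -> p = q.
Proof. by move=> ->; rewrite hh mulr0 addr0. Qed.

Let sqrt_polyS n : sqrt_poly n.+1 = sqrt_poly n + h * sqrt_defect n.
Proof. by rewrite /= mul_polyC. Qed.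

(** The recurrence for y_n = 1 - p_n is y_(n+1) = ((1 - X) + y_n^2) / 2. *)
Lemma cone_one_sub_sqrt n : poly_cone (1 - sqrt_poly n).
Proof.
elim: n => [|n IH]; first by rewrite subr0; exact: cone1.
rewrite (_ : _ - _ = 2^-1 *: ((1 - 'X) + (1 - sqrt_poly n) ^+ 2)).
  by apply: coneZ; [rewrite invr_ge0|apply: coneD; [exact: cone_1X|exact: cone_sq]].
rewrite sqrt_polyS /sqrt_defect -mul_polyC -/h.
by apply: (@half_eq (1 - sqrt_poly n)); ring.
Qed.

Lemma sqrt_defectS n : sqrt_defect n.+1 =
  sqrt_defect n * (2^-1 *: ((1 - sqrt_poly n) + (1 - sqrt_poly n.+1))).
Proof.
rewrite -mul_polyC -/h /(sqrt_defect n.+1) sqrt_polyS.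
set D := sqrt_defect n; have XE : 'X = D + sqrt_poly n ^+ 2 by rewrite subrK.
by apply: (@half_eq D); rewrite XE; ring.
Qed.

(** By the factorization above, the defect is X times a product of means of the
    polynomials 1 - p_n. *)
Lemma cone_sqrt_defect n : poly_cone (sqrt_defect n).
Proof.
elim: n => [|n IH]; first by rewrite /sqrt_defect /= expr0n subr0; exact: cone_X.
rewrite sqrt_defectS; apply: coneM => //; apply: coneZ; first by rewrite invr_ge0.
by apply: coneD; exact: cone_one_sub_sqrt.
Qed.

Lemma cone_sqrt n : poly_cone (sqrt_poly n).
Proof.
elim: n => [|n IH]; first exact: cone0.
by apply: coneD => //; apply: coneZ; [rewrite invr_ge0|exact: cone_sqrt_defect].
Qed.

Lemma cone_sqrt_sub m n : (m <= n)%N -> poly_cone (sqrt_poly n - sqrt_poly m).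
Proof.
elim: n => [|n IH]; first by rewrite leqn0 => /eqP ->; rewrite subrr; exact: cone0.
rewrite leq_eqVlt => /orP[/eqP ->|]; first by rewrite subrr; exact: cone0.
rewrite ltnS => /IH mn; rewrite /= addrAC; apply: coneD => //.
by apply: coneZ; [rewrite invr_ge0|exact: cone_sqrt_defect].
Qed.

Lemma cone_sqrt_defect_sub n : poly_cone (sqrt_defect n - sqrt_defect n.+1).
Proof.
rewrite sqrt_defectS (_ : _ - _ =
    sqrt_defect n * (2^-1 *: (sqrt_poly n + sqrt_poly n.+1))).
  apply: coneM; first exact: cone_sqrt_defect.
  by apply: coneZ; [rewrite invr_ge0|apply: coneD; exact: cone_sqrt].
rewrite -!mul_polyC -/h; set D := sqrt_defect n; set p := sqrt_poly n.
set p' := sqrt_poly _.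
by apply: (@half_eq D); ring.
Qed.

(** The defects decrease, and the first n of them add up to 2 p_n <= 2; hence n
    times the n-th one is at most 2. *)
Lemma cone_sqrt_defect_rate n : poly_cone (2%:P - n%:R *: sqrt_defect n).
Proof.
suff H : poly_cone (2 *: sqrt_poly n - n%:R *: sqrt_defect n).
  rewrite (_ : _ - _ = 2 *: (1 - sqrt_poly n) +
      (2 *: sqrt_poly n - n%:R *: sqrt_defect n)).
    by apply: coneD => //; apply: coneZ => //; exact: cone_one_sub_sqrt.
  by rewrite -!mul_polyC; ring.
elim: n => [|n IH]; first by rewrite scaler0 scale0r subrr; exact: cone0.
rewrite (_ : _ - _ = (2 *: sqrt_poly n - n%:R *: sqrt_defect n) +
    n.+1%:R *: (sqrt_defect n - sqrt_defect n.+1)).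
  by apply: coneD => //; apply: coneZ => //; exact: cone_sqrt_defect_sub.
apply: (@half_eq (- sqrt_defect n)); rewrite sqrt_polyS -!mul_polyC.
by rewrite -natr1 polyCD; ring.
Qed.

(** With p_m <= p_n, the difference is D_n + 2 p_m (p_n - p_m). *)
Lemma cone_sqrt_cauchy_le m n : (m <= n)%N ->
  poly_cone (sqrt_defect m - (sqrt_poly n - sqrt_poly m) ^+ 2).
Proof.
move=> mn; rewrite (_ : _ - _ = sqrt_defect n +
    2 *: (sqrt_poly m * (sqrt_poly n - sqrt_poly m))).
  apply: coneD; first exact: cone_sqrt_defect.
  by apply: coneZ => //; apply: coneM; [exact: cone_sqrt|exact: cone_sqrt_sub].
by rewrite -mul_polyC /sqrt_defect; ring.
Qed.

Lemma cone_sqrt_cauchy m n :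
  poly_cone (sqrt_defect m + sqrt_defect n - (sqrt_poly n - sqrt_poly m) ^+ 2).
Proof.
wlog mn : m n / (m <= n)%N.
  move=> H; have [mn|/ltnW nm] := leqP m n; first exact: H.
  by rewrite [_ + sqrt_defect n]addrC -sqrrN opprB; exact: H.
rewrite addrAC; apply: coneD; last exact: cone_sqrt_defect.
exact: cone_sqrt_cauchy_le.
Qed.

End positive_polynomials.

(** * Integral operators and their polynomials *)

Section integral_operators.
Context {R : realType} d (T : measurableType d) (mu : probability T R).
Implicit Types (A : T * T -> R) (f g : T -> R).

Definition inner f g : R := \int[mu]_x (f x * g x).

Definition kernel_op A f : T -> R := fun x => \int[mu]_y (A (x, y) * f y).

Definition kernel_comp A A' : T * T -> R :=
  fun p => \int[mu]_z (A (p.1, z) * A' (z, p.2)).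

Lemma prob_bRint_norm f M : bmf f -> (forall x, `|f x| <= M) ->
  `|\int[mu]_x f x| <= M.
Proof.
move=> bf fM; have E : fine (mu [set: T]) = 1 by rewrite probability_setT.
by rewrite -[leRHS]mulr1 -E; exact: bRint_norm.
Qed.

Lemma innerC f g : inner f g = inner g f.
Proof. by apply: eq_Rintegral => x _; rewrite mulrC. Qed.

Lemma innerDr f g g' : bmf f -> bmf g -> bmf g' ->
  inner f (fun x => g x + g' x) = inner f g + inner f g'.
Proof.
move=> bf bg bg'; rewrite /inner -bRintD; [|exact: bmfM..].
by apply: eq_Rintegral => x _; rewrite mulrDr.
Qed.

Lemma innerZr c f g : bmf f -> bmf g -> inner f (fun x => c * g x) = c * inner f g.
Proof.
move=> bf bg; rewrite /inner -bRintZ; last exact: bmfM.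
by apply: eq_Rintegral => x _; rewrite mulrCA.
Qed.

Lemma inner_ge0 f : 0 <= inner f f.
Proof. by apply: Rintegral_ge0 => x _; rewrite -expr2 sqr_ge0. Qed.

Let bmf_row A f : bmf A -> bmf f -> bmf (fun p : T * T => A p * f p.2).
Proof. by move=> bA bf; apply: bmfM => //; apply: (bmf_comp (h := snd)) bf. Qed.

Lemma bmf_kernel_op A f : bmf A -> bmf f -> bmf (kernel_op A f).
Proof. by move=> bA bf; exact: (bmf_intr mu (bmf_row bA bf)). Qed.

Let bmf_opint A f x : bmf A -> bmf f -> bmf (fun y => A (x, y) * f y).
Proof. by move=> bA bf; apply: bmfM => //; exact: bmf_sectr. Qed.

Lemma kernel_opD A f g : bmf A -> bmf f -> bmf g ->
  kernel_op A (fun x => f x + g x) = fun x => kernel_op A f x + kernel_op A g x.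
Proof.
move=> bA bf bg; apply/funext => x; rewrite /kernel_op -bRintD; [|exact: bmf_opint..].
by apply: eq_Rintegral => y _; rewrite mulrDr.
Qed.

Lemma kernel_opZ A c f : bmf A -> bmf f ->
  kernel_op A (fun x => c * f x) = fun x => c * kernel_op A f x.
Proof.
move=> bA bf; apply/funext => x; rewrite /kernel_op -bRintZ; last exact: bmf_opint.
by apply: eq_Rintegral => y _; rewrite mulrCA.
Qed.

Lemma kernel_op_addl A A' c f : bmf A -> bmf A' -> bmf f ->
  kernel_op (fun p => A p + c * A' p) f =
  fun x => kernel_op A f x + c * kernel_op A' f x.
Proof.
move=> bA bA' bf; apply/funext => x; rewrite /kernel_op -bRintZ; last exact: bmf_opint.
rewrite -bRintD; [|exact: bmf_opint|by apply: bmfZ; exact: bmf_opint].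
by apply: eq_Rintegral => y _; rewrite mulrDl mulrA.
Qed.

Lemma inner_kernel_op A f g : bmf A -> bmf f -> bmf g ->
  (forall x y, A (x, y) = A (y, x)) ->
  inner f (kernel_op A g) = inner (kernel_op A f) g.
Proof.
move=> bA bf bg symA.
have b : bmf (fun p : T * T => f p.1 * (A p * g p.2)).
  by apply: bmfM; [apply: (bmf_comp (h := fst))|exact: bmf_row].
transitivity (\int[mu]_x \int[mu]_y (f x * (A (x, y) * g y))).
  by apply: eq_Rintegral => x _; rewrite bRintZ//; exact: bmf_opint.
rewrite (bRint_swap mu mu b); apply: eq_Rintegral => y _ /=.
rewrite mulrC -bRintZ; last exact: bmf_opint.
by apply: eq_Rintegral => x _; rewrite (symA x); ring.
Qed.

Lemma bmf_kernel_comp A A' : bmf A -> bmf A' -> bmf (kernel_comp A A').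
Proof.
move=> bA bA'.
have b : bmf (fun q : (T * T) * T => A (q.1.1, q.2) * A' (q.2, q.1.2)).
  have m11 : measurable_fun [set: (T * T) * T] (fun q => q.1.1).
    exact: (measurableT_comp measurable_fst measurable_fst).
  have m12 : measurable_fun [set: (T * T) * T] (fun q => q.1.2).
    exact: (measurableT_comp measurable_snd measurable_fst).
  apply: bmfM.
    apply: (bmf_comp (h := fun q => (q.1.1, q.2))) bA.
    exact: measurable_fun_pair.
  apply: (bmf_comp (h := fun q => (q.2, q.1.2))) bA'.
  exact: measurable_fun_pair.
exact: (bmf_intr mu b).
Qed.

Lemma kernel_op_comp A A' f : bmf A -> bmf A' -> bmf f ->
  kernel_op (kernel_comp A A') f = kernel_op A (kernel_op A' f).
Proof.
move=> bA bA' bf; apply/funext => x.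
have bz y : bmf (fun z => A (x, z) * A' (z, y)).
  by apply: bmfM; [exact: bmf_sectr|exact: bmf_sectl].
have b : bmf (fun p : T * T => A (x, p.2) * (A' (p.2, p.1) * f p.1)).
  apply: bmfM.
    exact: (bmf_comp (h := snd) measurable_snd (bmf_sectr x bA)).
  apply: bmfM; last exact: (bmf_comp (h := fst) measurable_fst bf).
  apply: (bmf_comp (h := fun p => (p.2, p.1))) bA'.
  exact: measurable_fun_pair.
transitivity (\int[mu]_y \int[mu]_z (A (x, z) * (A' (z, y) * f y))).
  apply: eq_Rintegral => y _; rewrite /kernel_comp /= mulrC -bRintZ//.
  by apply: eq_Rintegral => z _; ring.
rewrite (bRint_swap mu mu b); apply: eq_Rintegral => z _ /=.
by rewrite bRintZ//; exact: bmf_opint.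
Qed.

Section polynomials.
Variables (K : T * T -> R) (bK : bmf K).
Hypothesis symK : forall x y, K (x, y) = K (y, x).
Implicit Types p q : {poly R}.

(** This is p (T) f, where T is the operator of K. *)
Definition poly_op p f : T -> R :=
  fun x => \sum_(i < size p) p`_i * iter i (kernel_op K) f x.

Let bmf_iter i f : bmf f -> bmf (iter i (kernel_op K) f).
Proof. by move=> bf; elim: i => [//|i IH] /=; exact: bmf_kernel_op. Qed.

Lemma bmf_poly_op p f : bmf f -> bmf (poly_op p f).
Proof. by move=> bf; apply: bmf_sum => i; apply: bmfZ; exact: bmf_iter. Qed.

Lemma poly_op_wide n p f x : (size p <= n)%N ->
  poly_op p f x = \sum_(i < n) p`_i * iter i (kernel_op K) f x.
Proof.
move=> pn; rewrite /poly_op.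
rewrite (big_ord_widen_cond n xpredT (fun i => p`_i * iter i (kernel_op K) f x))//=.
rewrite big_mkcond; apply: eq_bigr => i _; case: ltnP => // ip.
by rewrite nth_default// mul0r.
Qed.

Lemma poly_opD p q f x : poly_op (p + q) f x = poly_op p f x + poly_op q f x.
Proof.
have [pn qn] : (size p <= maxn (size p) (size q))%N /\
    (size q <= maxn (size p) (size q))%N by rewrite leq_maxl leq_maxr.
rewrite !(@poly_op_wide (maxn (size p) (size q)))// ?size_polyD//.
by rewrite -big_split; apply: eq_bigr => i _; rewrite coefD mulrDl.
Qed.

Lemma poly_opZ c p f x : poly_op (c *: p) f x = c * poly_op p f x.
Proof.
rewrite (poly_op_wide _ _ (size_scale_leq c p)) mulr_sumr.
by apply: eq_bigr => i _; rewrite coefZ mulrA.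
Qed.

Lemma poly_opB p q f x : poly_op (p - q) f x = poly_op p f x + (-1) * poly_op q f x.
Proof. by rewrite poly_opD -scaleN1r poly_opZ. Qed.

Lemma poly_op1 f x : poly_op 1 f x = f x.
Proof. by rewrite /poly_op size_poly1 big_ord1 coef1 mul1r. Qed.

Lemma poly_opMX p f x : poly_op (p * 'X) f x = poly_op p (kernel_op K f) x.
Proof.
rewrite (@poly_op_wide (size p).+1); last first.
  by rewrite (leq_trans (size_polyMleq _ _))// size_polyX addn2.
rewrite big_ord_recl coefMX mul0r add0r; apply: eq_bigr => i _.
by rewrite coefMX /= -iterSr.
Qed.

Lemma poly_opX f x : poly_op 'X f x = kernel_op K f x.
Proof. by rewrite -['X]mul1r poly_opMX poly_op1. Qed.

Lemma poly_opMXaddC p c f x :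
  poly_op (p * 'X + c%:P) f x = poly_op p (kernel_op K f) x + c * f x.
Proof. by rewrite poly_opD poly_opMX -alg_polyC poly_opZ poly_op1. Qed.

Lemma poly_op0 f x : poly_op 0 f x = 0.
Proof. by rewrite /poly_op size_poly0 big_ord0. Qed.

Lemma poly_op_kernel_op p f : bmf f ->
  poly_op p (kernel_op K f) = kernel_op K (poly_op p f).
Proof.
elim/poly_ind: p f => [|p c IH] f bf.
  rewrite (funext (poly_op0 _)) (funext (poly_op0 _)) -[in RHS](@mul0r R 0).
  rewrite kernel_opZ//; last exact: bmf_cst.
  by apply/funext => x; rewrite mul0r.
have bKf := bmf_kernel_op bK bf.
rewrite (funext (poly_opMXaddC p c f)) kernel_opD//; [|exact: bmf_poly_op|exact: bmfZ].
rewrite kernel_opZ// -IH//.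
exact/funext/poly_opMXaddC.
Qed.

Lemma poly_opM p q f : bmf f -> poly_op (p * q) f = poly_op p (poly_op q f).
Proof.
move=> bf; elim/poly_ind: p q => [|p c IH] q; apply/funext => x.
  by rewrite mul0r !poly_op0.
rewrite poly_opMXaddC mulrDl poly_opD mul_polyC poly_opZ -mulrA IH.
congr (poly_op p _ x + _); apply/funext => y.
by rewrite mulrC poly_opMX poly_op_kernel_op.
Qed.

Lemma inner_poly_op p f g : bmf f -> bmf g ->
  inner f (poly_op p g) = inner (poly_op p f) g.
Proof.
move=> bf bg; elim/poly_ind: p g bg => [|p c IH] g bg.
  rewrite /inner; apply: eq_Rintegral => x _.
  by rewrite !poly_op0 mul0r mulr0.
have bKg := bmf_kernel_op bK bg; have bKf := bmf_kernel_op bK bf.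
rewrite (funext (poly_opMXaddC p c g)) (funext (poly_opMXaddC p c f)).
rewrite innerDr ?innerZr//; [|exact: bmf_poly_op|exact: bmfZ].
rewrite IH// inner_kernel_op//; last exact: bmf_poly_op.
rewrite -poly_op_kernel_op// [RHS]innerC.
rewrite innerDr ?innerZr//; [|exact: bmf_poly_op|exact: bmfZ].
by rewrite innerC [inner g f]innerC.
Qed.

(** Here 0 <= T is assumed and T <= 1 follows from |K| <= 1, as
    K (x, y) g x g y <= ((g x)^2 + (g y)^2) / 2. The three conditions reduce to
    these by moving one factor q (T) across the inner product. *)
Lemma inner_poly_op_interval_positive f : bmf f ->
  (forall g, bmf g -> 0 <= inner g (kernel_op K g)) ->
  (forall z, `|K z| <= 1) ->
  interval_positive (fun p => inner f (poly_op p f)).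
Proof.
move=> bf posK K1.
have sq p q : inner f (poly_op (p * q ^+ 2) f) =
    inner (poly_op q f) (poly_op p (poly_op q f)).
  rewrite (_ : p * q ^+ 2 = q * (p * q)); last by ring.
  by rewrite !poly_opM ?inner_poly_op//; do ?apply: bmf_poly_op.
have le1 g : bmf g -> inner g (kernel_op K g) <= inner g g.
  move=> bg; have bgg : bmf (fun x => g x * g x) by exact: bmfM.
  have int1 c : \int[mu]_(_ in setT) c = c.
    rewrite Rintegral_cst// -[RHS]mulr1; congr (c * _).
    by rewrite -[RHS]/(fine 1%E); congr fine; exact: probability_setT.
  have row x : g x * kernel_op K g x <= 2^-1 * (g x * g x) + 2^-1 * inner g g.
    rewrite [leRHS](_ : _ =
      \int[mu]_y (2^-1 * (g x * g x) + 2^-1 * (g y * g y))); last first.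
      by rewrite bRintD ?int1 ?bRintZ//; [exact: bmf_cst|exact: bmfZ].
    rewrite -bRintZ; last exact: bmf_opint.
    apply: bRint_le => [||y]; first by apply: bmfZ; exact: bmf_opint.
      by apply: bmfD; [exact: bmf_cst|exact: bmfZ].
    rewrite (le_trans (ler_norm _))// !normrM.
    have := sqr_ge0 (`|g x| - `|g y|).
    rewrite -[g x * g x]expr2 -[g y * g y]expr2.
    rewrite -(real_normK (num_real (g x))) -(real_normK (num_real (g y))).
    have := K1 (x, y); move: `|K _| `|g x| `|g y| (normr_ge0 (K (x, y)))
      (normr_ge0 (g x)) (normr_ge0 (g y)) => k u v k0 u0 v0 k1 uv.
    have : k * (u * v) <= u * v by rewrite ler_piMl// mulr_ge0.
    by nra.
  rewrite [leRHS](_ : _ = \int[mu]_x (2^-1 * (g x * g x) + 2^-1 * inner g g)).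
    apply: bRint_le => //; first by apply: bmfM => //; exact: bmf_kernel_op.
    by apply: bmfD; [exact: bmfZ|exact: bmf_cst].
  rewrite bRintD; [|exact: bmfZ|exact: bmf_cst].
  by rewrite int1 bRintZ// -/(inner g g); lra.
split.
- move=> p q; rewrite (funext (poly_opD p q f)) innerDr//; exact: bmf_poly_op.
- move=> c p; rewrite (funext (poly_opZ c p f)) innerZr//; exact: bmf_poly_op.
- move=> q; rewrite -[q ^+ 2]mul1r sq (funext (poly_op1 _)); exact: inner_ge0.
- move=> q; rewrite sq (funext (poly_opX _)); apply: posK; exact: bmf_poly_op.
- move=> q; rewrite sq; set g := poly_op q f; have bg : bmf g by exact: bmf_poly_op.
  have -> : poly_op (1 - 'X) g = fun x => g x + (-1) * kernel_op K g x.
    by apply/funext => x; rewrite poly_opB poly_op1 poly_opX.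
  have bKg := bmf_kernel_op bK bg.
  by rewrite innerDr ?innerZr//; [have := le1 g bg; lra|exact: bmfZ].
Qed.

End polynomials.
End integral_operators.
(** * Averages over small balls *)

Section averages.
Context {R : realType} d (T : measurableType d) (mu : probability T R).
Implicit Types (A : T * T -> R) (f g w : T -> R).

Definition weight w : Prop := [/\ bmf w, forall x, 0 <= w x & \int[mu]_x w x = 1].

Lemma weighted_mean_approx w h c e : weight w -> bmf h ->
  (forall x, w x != 0 -> `|h x - c| <= e) -> `|\int[mu]_x (h x * w x) - c| <= e.
Proof.
move=> [bw w0 w1] bh hc.
have bhw : bmf (fun x => h x * w x) by exact: bmfM.
have -> : \int[mu]_x (h x * w x) - c = \int[mu]_x (h x * w x - c * w x).
  by rewrite bRintB//; [rewrite bRintZ// w1 mulr1|exact: bmfZ].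
have pw x : `|h x * w x - c * w x| <= e * w x.
  rewrite -mulrBl normrM (ger0_norm (w0 x)).
  have [->|wx] := eqVneq (w x) 0; first by rewrite !mulr0.
  by rewrite ler_wpM2r//; exact: hc.
have ew : \int[mu]_x (e * w x) = e by rewrite bRintZ// w1 mulr1.
have bd : bmf (fun x => h x * w x - c * w x) by apply: bmfB => //; exact: bmfZ.
rewrite ler_norml; apply/andP; split.
  rewrite -[in leLHS]ew -mulN1r -bRintZ; last exact: bmfZ.
  apply: bRint_le => // [|x]; first by do 2 apply: bmfZ.
  by have := pw x; rewrite ler_norml mulN1r => /andP[].
rewrite -[in leRHS]ew; apply: bRint_le => // [|x]; first exact: bmfZ.
by have := pw x; rewrite ler_norml => /andP[].
Qed.

Definition form A f g : R := inner mu f (kernel_op mu A g).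

Lemma form_weighted_approx A w w' c e : bmf A -> weight w -> weight w' ->
  (forall x y, w x != 0 -> w' y != 0 -> `|A (x, y) - c| <= e) ->
  `|form A w w' - c| <= e.
Proof.
move=> bA ww ww' Ac; have [bw' _ _] := ww'.
rewrite /form innerC; apply: weighted_mean_approx => //; first exact: bmf_kernel_op.
move=> x wx; apply: weighted_mean_approx => //; first exact: bmf_sectr.
by move=> y wy; exact: Ac.
Qed.

Lemma form_addl A A' c f g : bmf A -> bmf A' -> bmf f -> bmf g ->
  form (fun p => A p + c * A' p) f g = form A f g + c * form A' f g.
Proof.
move=> bA bA' bf bg; have b1 := bmf_kernel_op mu bA bg.
have b2 := bmf_kernel_op mu bA' bg.
by rewrite /form kernel_op_addl// innerDr ?innerZr//; exact: bmfZ.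
Qed.

Lemma form_square_add A f g t : bmf A -> (forall x y, A (x, y) = A (y, x)) ->
  bmf f -> bmf g ->
  form A (fun x => f x + t * g x) (fun x => f x + t * g x) =
  form A f f + 2 * t * form A f g + t ^+ 2 * form A g g.
Proof.
move=> bA symA bf bg; have btg : bmf (fun x => t * g x) by exact: bmfZ.
have b1 := bmf_kernel_op mu bA bf; have b2 := bmf_kernel_op mu bA bg.
have b3 : bmf (fun x => t * kernel_op mu A g x) by exact: bmfZ.
have right h : bmf h ->
    form A h (fun x => f x + t * g x) = form A h f + t * form A h g.
  by move=> bh; rewrite /form kernel_opD// kernel_opZ// innerDr// innerZr.
have sym h h' : bmf h -> bmf h' -> form A h h' = form A h' h.
  by move=> bh bh'; rewrite /form inner_kernel_op// innerC.
have bs : bmf (fun x => f x + t * g x) by exact: bmfD.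
by rewrite right// !(sym (fun x => f x + t * g x))// !right// (sym g f)//; ring.
Qed.

End averages.

Section ball_averages.
Context {R : realType} {Omega : pointedMetricType R}.
Hypothesis cptOmega : compact [set: Omega].
Notation B := (borelType Omega).
Variable mu : probability B R.
Hypothesis supp_mu : measure_support mu = [set: Omega].

(* The interior makes the measurability of balls immediate. *)
Let U (x : Omega) (r : R) : set B := (ball x r)^°.

Let mU x r : measurable (U x r).
Proof. by apply: borel_open; exact: open_interior. Qed.

Definition ball_mass x r : R := fine (mu (U x r)).

Lemma ball_mass_gt0 x r : 0 < r -> 0 < ball_mass x r.
Proof.
move=> r0; apply: fine_gt0; rewrite ltey_eq fin_num_measure// andbT.
have : measure_support mu x by rewrite supp_mu.
by apply; [exact: open_interior|exact: nbhsx_ballx].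
Qed.

(** Every ball of radius r contains one of the finitely many balls of radius
    r / 2 around the points of a net, each of which has positive mass. *)
Lemma ball_mass_bounded_below r : 0 < r ->
  exists2 c, 0 < c & forall x, c <= ball_mass x r.
Proof.
move=> r0; have r20 : 0 < r / 2 by rewrite divr_gt0.
have [s sP] := finite_net cptOmega r20.
have [c c0 cP] : exists2 c, 0 < c & forall y, y \in s -> c <= ball_mass y (r / 2).
  elim: s {sP} => [|y s [c c0 IH]]; first by exists 1.
  exists (Num.min c (ball_mass y (r / 2))); first by rewrite lt_min c0 ball_mass_gt0.
  by move=> z; rewrite inE => /orP[/eqP ->|/IH cz]; rewrite ge_min ?lexx ?orbT// cz.
exists c => // x; have /hasP[y ys /asboolP xy] := sP x.
apply: le_trans (cP y ys) _; apply: fine_le; rewrite ?fin_num_measure//.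
apply: le_measure; rewrite ?inE//; apply: interiorS => z yz.
have : ball x (r / 2 + r / 2) z.
  by apply: ball_triangle yz; apply: ball_sym; exact: interior_subset xy.
by rewrite -splitr.
Qed.

Definition ball_average x r : B -> R := fun z => (ball_mass x r)^-1 * \1_(U x r) z.

Lemma bmf_ball_average x r : bmf (ball_average x r).
Proof. by apply: bmfZ; exact: bmf_indic. Qed.

Let int_indic x r : \int[mu]_z (\1_(U x r) z : R) = ball_mass x r.
Proof. by rewrite /Rintegral integral_indic// setIT. Qed.

Lemma weight_ball_average x r : 0 < r -> weight mu (ball_average x r).
Proof.
move=> r0; have m0 := ball_mass_gt0 x r0; split.
- exact: bmf_ball_average.
- by move=> z; rewrite mulr_ge0// ?invr_ge0 ?ltW// indicE.
- by rewrite bRintZ ?int_indic ?mulVf ?gt_eqF//; exact: bmf_indic.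
Qed.

Lemma inner_ball_average x r : 0 < r ->
  inner mu (ball_average x r) (ball_average x r) = (ball_mass x r)^-1.
Proof.
move=> r0; have m0 := ball_mass_gt0 x r0.
transitivity (\int[mu]_z ((ball_mass x r)^-1 * ball_average x r z)).
  apply: eq_Rintegral => z _; rewrite /ball_average indicE.
  by case: (_ \in _); rewrite /= ?mulr0 ?mulr1.
have [b _ w1] := weight_ball_average x r0.
by rewrite bRintZ// w1 mulr1.
Qed.

Lemma ball_average_supp x r z : ball_average x r z != 0 -> ball x r z.
Proof.
rewrite /ball_average indicE.
case: (boolP (z \in _)) => [|_]; last by rewrite mulr0 eqxx.
by rewrite inE => /interior_subset.
Qed.

Lemma form_ball_average (A : Omega * Omega -> R) e : continuous A -> 0 < e ->
  exists2 d, 0 < d & forall x y r s, 0 < r <= d -> 0 < s <= d ->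
    `|form mu A (ball_average x r) (ball_average y s) - A (x, y)| <= e.
Proof.
move=> cA e0; have [d d0 dP] := compact_uniform_continuity cptOmega cA e0.
exists d => // x y r s /andP[r0 rd] /andP[s0 sd].
apply: form_weighted_approx; first exact: continuous_bmf2.
- exact: weight_ball_average.
- exact: weight_ball_average.
move=> u v /ball_average_supp xu /ball_average_supp yv; rewrite distrC ltW//.
by apply: dP; [exact: le_ball xu|exact: le_ball yv].
Qed.

(** The right-hand side is the value of the form at the point mass at x plus t
    times the one at y, which is a limit of values at ball averages. *)
Lemma form_ge0_pointwise (A : Omega * Omega -> R) :
  continuous A -> (forall x y, A (x, y) = A (y, x)) ->
  (forall f : B -> R, bmf f -> 0 <= form mu A f f) ->
  forall x y t, 0 <= A (x, x) + 2 * t * A (x, y) + t ^+ 2 * A (y, y).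
Proof.
move=> cA symA posA x y t; apply/ler_addgt0Pl => e e0.
set N := 1 + 2 * `|t| + t ^+ 2.
have N0 : 0 < N by rewrite /N; have := normr_ge0 t; have := sqr_ge0 t; lra.
have [d d0 dP] := form_ball_average cA (divr_gt0 e0 N0).
have dd : 0 < d <= d by rewrite d0 lexx.
have := posA _ (bmfD (bmf_ball_average x d) (bmfZ t (bmf_ball_average y d))).
have bA := continuous_bmf2 cptOmega cA.
rewrite (form_square_add _ t bA symA (bmf_ball_average _ _) (bmf_ball_average _ _)).
move: (dP x x d d dd dd) (dP x y d d dd dd) (dP y y d d dd dd).
set a := form mu A (ball_average x d) (ball_average x d).
set b := form mu A (ball_average x d) (ball_average y d).
set c := form mu A (ball_average y d) (ball_average y d) => ha hb hc abc.
have ht : `|2 * t * (b - A (x, y))| <= 2 * `|t| * (e / N).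
  by rewrite normrM [`|2 * t|]normrM ger0_norm// ler_wpM2l// mulr_ge0.
have hc' : `|t ^+ 2 * (c - A (y, y))| <= t ^+ 2 * (e / N).
  by rewrite normrM (ger0_norm (sqr_ge0 t)) ler_wpM2l ?sqr_ge0//.
have eN : e = e / N + 2 * `|t| * (e / N) + t ^+ 2 * (e / N).
  by rewrite -[LHS](divfK (lt0r_neq0 N0)) {2}/N; ring.
move: abc ha ht hc'; rewrite !ler_norml => ? /andP[? ?] /andP[? ?] /andP[? ?].
by rewrite eN; lra.
Qed.

End ball_averages.

(** * The approximate square roots of a kernel *)

Section sqrt_kernels.
Context {R : realType} {Omega : pointedMetricType R}.
Hypothesis cptOmega : compact [set: Omega].
Notation B := (borelType Omega).
Variable mu : probability B R.

Lemma continuous_kernel_comp (A A' : Omega * Omega -> R) :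
  continuous A -> continuous A' ->
  continuous (kernel_comp mu A A' : Omega * Omega -> R).
Proof.
move=> cA cA' p; apply/cvgrPdist_le => e e0.
have [M M0 MP] := compact_kernel_bounded cptOmega cA.
have [M' M0' MP'] := compact_kernel_bounded cptOmega cA'.
have eM : 0 < e / (2 * M) by rewrite divr_gt0// mulr_gt0.
have eM' : 0 < e / (2 * M') by rewrite divr_gt0// mulr_gt0.
have [d d0 dP] := compact_uniform_continuity cptOmega cA eM'.
have [d' d0' dP'] := compact_uniform_continuity cptOmega cA' eM.
have bA := continuous_bmf2 cptOmega cA; have bA' := continuous_bmf2 cptOmega cA'.
have bz (q : B * B) : bmf (fun z : B => A (q.1, z) * A' (z, q.2)).
  by apply: bmfM; [exact: (bmf_sectr q.1 bA)|exact: (bmf_sectl q.2 bA')].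
have dd : 0 < Num.min d d' by rewrite lt_min d0.
near=> q.
have [p1 p2] : ball (p : Omega * Omega) (Num.min d d') q.
  by near: q; exact: (nbhsx_ballx (p : Omega * Omega) _ dd).
rewrite /kernel_comp -(bRintB mu (bz p) (bz q)).
apply: prob_bRint_norm; first exact: bmfB.
move=> z.
have h1 : `|A (p.1, z) - A (q.1, z)| <= e / (2 * M').
  apply/ltW/dP; last exact: ballxx.
  by apply: le_ball p1; rewrite ge_min lexx.
have h2 : `|A' (z, p.2) - A' (z, q.2)| <= e / (2 * M).
  apply/ltW/dP'; first exact: ballxx.
  by apply: le_ball p2; rewrite ge_min lexx orbT.
rewrite (_ : _ - _ = (A (p.1, z) - A (q.1, z)) * A' (z, p.2) +
  A (q.1, z) * (A' (z, p.2) - A' (z, q.2))); last by ring.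
rewrite (le_trans (ler_normD _ _))// !normrM.
rewrite (_ : e = e / (2 * M') * M' + M * (e / (2 * M))); last first.
  by field; rewrite !gt_eqF.
by apply: lerD; apply: ler_pM.
Unshelve. all: by end_near. Qed.

Lemma sym_kernel_comp (A : B * B -> R) : (forall x y, A (x, y) = A (y, x)) ->
  forall x y, kernel_comp mu A A (x, y) = kernel_comp mu A A (y, x).
Proof.
move=> symA x y; apply: eq_Rintegral => z _ /=.
by rewrite (symA z) (symA x) mulrC.
Qed.

Variable K : Omega * Omega -> R.
Hypotheses (cK : continuous K) (symK : is_symmetric K) (psdK : finitely_psd K).
Hypothesis K1 : forall p, `|K p| <= 1.

Let bK : bmf (K : B * B -> R) := continuous_bmf2 cptOmega cK.

(** The iteration of [sqrt_poly], with composition of kernels as product. *)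
Fixpoint sqrt_kernel (n : nat) : Omega * Omega -> R :=
  if n is m.+1 then
    fun p => sqrt_kernel m p +
      2^-1 * (K p + (-1) * kernel_comp mu (sqrt_kernel m) (sqrt_kernel m) p)
  else fun=> 0.

Definition sqrt_square n : Omega * Omega -> R :=
  kernel_comp mu (sqrt_kernel n) (sqrt_kernel n).

Definition defect_kernel n : Omega * Omega -> R :=
  fun p => K p + (-1) * sqrt_square n p.

Definition difference_kernel m n : Omega * Omega -> R :=
  fun p => sqrt_kernel n p + (-1) * sqrt_kernel m p.

Let cont_addZ (f g : Omega * Omega -> R) c :
  continuous f -> continuous g -> continuous (fun p => f p + c * g p).
Proof.
by move=> cf cg p; apply: cvgD; [exact: cf|apply: cvgM; [exact: cvg_cst|exact: cg]].
Qed.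

Lemma continuous_sqrt_kernel n : continuous (sqrt_kernel n).
Proof.
elim: n => [|n IH] /=; first by move=> p; exact: cvg_cst.
by do 2 apply: cont_addZ => //; exact: continuous_kernel_comp.
Qed.

Lemma sym_sqrt_kernel n x y : sqrt_kernel n (x, y) = sqrt_kernel n (y, x).
Proof.
elim: n x y => [//|n IH] x y /=.
by rewrite IH symK (sym_kernel_comp IH).
Qed.

Lemma continuous_defect_kernel n : continuous (defect_kernel n).
Proof.
by apply: cont_addZ => //; apply: continuous_kernel_comp; exact: continuous_sqrt_kernel.
Qed.

Lemma sym_defect_kernel n x y : defect_kernel n (x, y) = defect_kernel n (y, x).
Proof.
by rewrite /defect_kernel symK /sqrt_square (sym_kernel_comp (@sym_sqrt_kernel n)).
Qed.

Lemma continuous_difference_kernel m n : continuous (difference_kernel m n).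
Proof. by apply: cont_addZ => //; exact: continuous_sqrt_kernel. Qed.

Lemma sym_difference_kernel m n x y :
  difference_kernel m n (x, y) = difference_kernel m n (y, x).
Proof. by rewrite /difference_kernel !(sym_sqrt_kernel _ x). Qed.

Let bmf_sqrt_kernel n : bmf (sqrt_kernel n : B * B -> R).
Proof. apply: continuous_bmf2 => //; exact: continuous_sqrt_kernel. Qed.

Let bmf_defect_kernel n : bmf (defect_kernel n : B * B -> R).
Proof. apply: continuous_bmf2 => //; exact: continuous_defect_kernel. Qed.

Let bmf_difference_kernel m n : bmf (difference_kernel m n : B * B -> R).
Proof. apply: continuous_bmf2 => //; exact: continuous_difference_kernel. Qed.

Notation Kop p f := (poly_op mu K p f).

Lemma kernel_op_sqrt_kernel n (f : B -> R) : bmf f ->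
  kernel_op mu (sqrt_kernel n) f = Kop (sqrt_poly n) f.
Proof.
elim: n f => [|n IH] f bf.
  apply/funext => x; rewrite poly_op0 /kernel_op /=.
  by under eq_Rintegral do rewrite mul0r; rewrite Rintegral_cst// mul0r.
have bc := bmf_kernel_comp mu (bmf_sqrt_kernel n) (bmf_sqrt_kernel n).
apply/funext => x; rewrite /= poly_opD poly_opZ poly_opB.
have bP := bmf_poly_op mu bK (sqrt_poly n) bf.
rewrite expr2 (poly_opM mu bK)// poly_opX -!IH//.
rewrite (kernel_op_addl mu (A := sqrt_kernel n)
  (A' := fun p => K p + (-1) * kernel_comp mu (sqrt_kernel n) (sqrt_kernel n) p))//.
- by rewrite (kernel_op_addl mu (A := K))// kernel_op_comp.
- by apply: bmfD => //; exact: bmfZ.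
- by rewrite IH.
Qed.

Let kernel_op_sqrt_square n (f : B -> R) : bmf f ->
  kernel_op mu (sqrt_square n) f = Kop (sqrt_poly n ^+ 2) f.
Proof.
move=> bf; rewrite /sqrt_square kernel_op_comp// expr2 (poly_opM mu bK)//.
by rewrite !kernel_op_sqrt_kernel//; exact: bmf_poly_op.
Qed.

Lemma kernel_op_defect_kernel n (f : B -> R) : bmf f ->
  kernel_op mu (defect_kernel n) f = Kop (sqrt_defect n) f.
Proof.
move=> bf; apply/funext => x.
rewrite /sqrt_defect poly_opB poly_opX -kernel_op_sqrt_square//.
rewrite (kernel_op_addl mu (A := K))//; exact: bmf_kernel_comp.
Qed.

Lemma kernel_op_difference_kernel m n (f : B -> R) : bmf f ->
  kernel_op mu (difference_kernel m n) f = Kop (sqrt_poly n - sqrt_poly m) f.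
Proof.
move=> bf; apply/funext => x.
rewrite poly_opB -!kernel_op_sqrt_kernel//.
by rewrite (kernel_op_addl mu (A := sqrt_kernel n)).
Qed.

(** Integration against the density f is a bounded functional. *)
Lemma form_kernel_ge0 (f : B -> R) : bmf f -> 0 <= form mu K f f.
Proof.
move=> bf; have [M M0 fM] : exists2 M, 0 < M & forall x, `|f x| <= M.
  have [_ [M fM]] := bf; exists (`|M| + 1); first by rewrite ltr_wpDl.
  move=> x; rewrite (le_trans (fM x))// (le_trans (ler_norm M))//.
  by rewrite lerDl.
have bS : bounded_functional M (fun g => \int[mu]_x (g x * f x)).
  split => //.
  - move=> g g' bg bg'; rewrite -bRintD; [|exact: bmfM..].
    by apply: eq_Rintegral => x _; rewrite mulrDl.
  - move=> c g bg; rewrite -bRintZ; last exact: bmfM.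
    by apply: eq_Rintegral => x _; rewrite mulrA.
  - move=> g N bg gN; apply: prob_bRint_norm; first exact: bmfM.
    by move=> x; rewrite normrM mulrC ler_pM.
have := @bfun_quad_ge0 _ _ cptOmega M _ K bS cK psdK.
congr (0 <= _); rewrite /form innerC; apply: eq_Rintegral => y _.
by congr (_ * _); apply: eq_Rintegral => x _; rewrite symK.
Qed.

Lemma cone_form_ge0 p (A : B * B -> R) (f : B -> R) : poly_cone p ->
  kernel_op mu A f = Kop p f -> bmf f -> 0 <= form mu A f f.
Proof.
move=> cp AE bf; rewrite /form AE; apply: (cp (fun p => inner mu f (Kop p f))).
by apply: inner_poly_op_interval_positive => //; exact: form_kernel_ge0.
Qed.

Lemma form_defect_ge0 n (f : B -> R) : bmf f -> 0 <= form mu (defect_kernel n) f f.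
Proof.
move=> bf; apply: (cone_form_ge0 (@cone_sqrt_defect _ n)) => //.
exact: kernel_op_defect_kernel.
Qed.

Lemma form_defect_le n (f : B -> R) : bmf f ->
  form mu (defect_kernel n) f f <= form mu K f f.
Proof.
move=> bf; rewrite -subr_ge0.
have bs := bmf_kernel_comp mu (bmf_sqrt_kernel n) (bmf_sqrt_kernel n).
rewrite /defect_kernel (form_addl mu _ (A := K))// mulN1r opprB addrC subrK.
apply: (cone_form_ge0 (@cone_sq _ (sqrt_poly n))) => //.
exact: kernel_op_sqrt_square.
Qed.

Lemma form_defect_rate n (f : B -> R) : bmf f ->
  n%:R * form mu (defect_kernel n) f f <= 2 * inner mu f f.
Proof.
move=> bf; rewrite -subr_ge0.
have := @cone_sqrt_defect_rate R n (fun p => inner mu f (Kop p f))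
  (inner_poly_op_interval_positive bK symK bf form_kernel_ge0 K1).
rewrite /form kernel_op_defect_kernel//; congr (0 <= _).
have bD := bmf_poly_op mu bK (sqrt_defect n) bf.
rewrite -alg_polyC (_ : Kop _ f =
    fun x => 2 * f x + (- n%:R) * Kop (sqrt_defect n) f x).
  by rewrite innerDr ?innerZr ?mulNr//; exact: bmfZ.
by apply/funext => x; rewrite poly_opB !poly_opZ poly_op1; ring.
Qed.

Lemma form_difference_le m n (f : B -> R) : bmf f ->
  form mu (kernel_comp mu (difference_kernel m n) (difference_kernel m n)) f f <=
  form mu (defect_kernel m) f f + form mu (defect_kernel n) f f.
Proof.
move=> bf; rewrite -subr_ge0.
have := @cone_sqrt_cauchy R m n (fun p => inner mu f (Kop p f))
  (inner_poly_op_interval_positive bK symK bf form_kernel_ge0 K1).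
have bd := bmf_poly_op mu bK (sqrt_poly n - sqrt_poly m) bf.
rewrite /form !kernel_op_defect_kernel// kernel_op_comp//.
rewrite (kernel_op_difference_kernel m n bf) (kernel_op_difference_kernel m n bd).
rewrite -(poly_opM mu bK)// -expr2; congr (0 <= _).
have bD k := bmf_poly_op mu bK (sqrt_defect k) bf.
have bE := bmf_poly_op mu bK ((sqrt_poly n - sqrt_poly m) ^+ 2) bf.
rewrite (_ : Kop _ f = fun x => (Kop (sqrt_defect m) f x + Kop (sqrt_defect n) f x) +
    (-1) * Kop ((sqrt_poly n - sqrt_poly m) ^+ 2) f x).
  rewrite innerDr ?innerZr//; [|exact: bmfD|exact: bmfZ].
  by rewrite innerDr// mulN1r.
by apply/funext => x; rewrite poly_opB poly_opD.
Qed.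

Hypothesis supp_mu : measure_support mu = [set: Omega].

Lemma defect_kernel_le_diag n x y :
  2 * `|defect_kernel n (x, y)| <= defect_kernel n (x, x) + defect_kernel n (y, y).
Proof.
have H := form_ge0_pointwise cptOmega supp_mu (@continuous_defect_kernel n)
  (@sym_defect_kernel n) (@form_defect_ge0 n) x y.
have := H 1; have := H (-1); rewrite sqrrN expr1n !mul1r => h1 h2.
by case: ger0P => _; lra.
Qed.

(** By symmetry the left-hand side is the squared L^2 norm of the section at x of
    the difference of two approximate square roots. *)
Lemma difference_kernel_le_diag m n x :
  kernel_comp mu (difference_kernel m n) (difference_kernel m n) (x, x) <=
  defect_kernel m (x, x) + defect_kernel n (x, x).
Proof.
set E := kernel_comp mu _ _.
have cE : continuous (E : Omega * Omega -> R).
  by apply: continuous_kernel_comp; exact: continuous_difference_kernel.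
have symE := sym_kernel_comp (@sym_difference_kernel m n).
pose G : Omega * Omega -> R := fun p =>
  (defect_kernel m p + 1 * defect_kernel n p) + (-1) * E p.
have cG : continuous G.
  apply: cont_addZ => //; apply: (cont_addZ (f := defect_kernel m));
    exact: continuous_defect_kernel.
have symG u v : G (u, v) = G (v, u).
  by rewrite /G !(sym_defect_kernel _ u) /E symE.
have bE : bmf (E : B * B -> R) by exact: bmf_kernel_comp.
have posG (f : B -> R) : bmf f -> 0 <= form mu G f f.
  move=> bf; rewrite /G (form_addl mu _ (A := fun p =>
    defect_kernel m p + 1 * defect_kernel n p))//; last first.
    by apply: bmfD => //; exact: bmfZ.
  rewrite (form_addl mu _ (A := defect_kernel m))// mul1r mulN1r subr_ge0.
  exact: form_difference_le.
have := form_ge0_pointwise cptOmega supp_mu cG symG posG x x 0.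
by rewrite /G mulr0 expr0n !mul0r !addr0 mul1r mulN1r subr_ge0.
Qed.

(** At scale s the decay of the defect as an operator controls its form at ball
    averages; the defect on the diagonal differs from it by at most an
    oscillation of K, because K dominates the defect as a form. *)
Lemma defect_kernel_diag_cvg e : 0 < e ->
  exists n, forall x, defect_kernel n (x, x) <= e.
Proof.
move=> e0.
have e16 : 0 < e / 16 by lra.
have [s s0 sP] := form_ball_average cptOmega supp_mu cK e16.
have [c c0 cP] := ball_mass_bounded_below cptOmega supp_mu s0.
pose n := (Num.truncn (16 / (e * c))).+1.
exists n => x.
have n0 : 0 < n%:R :> R by rewrite ltr0n.
have nc : 2 / c <= n%:R * (e / 8).
  have : 16 / (e * c) <= n%:R by rewrite ltW// truncnS_gt.
  rewrite !ler_pdivrMr// ?mulr_gt0// (_ : n%:R * (e / 8) * c = (n%:R * (e * c)) / 8).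
    by lra.
  by ring.
have cD := @continuous_defect_kernel n.
have e4 : 0 < e / 4 by lra.
have [d d0 dP] := form_ball_average cptOmega supp_mu cD e4.
(* The radius r depends on n, the radius s does not. *)
pose r := Num.min d s.
have r0 : 0 < r by rewrite lt_min d0.
have rd : 0 < r <= d by rewrite r0 ge_min lexx.
have rs : 0 < r <= s by rewrite r0 ge_min lexx orbT.
have ss : 0 < s <= s by rewrite s0 lexx.
set u := ball_average mu x r; set v := ball_average mu x s.
have bu : bmf u by exact: bmf_ball_average.
have bv : bmf v by exact: bmf_ball_average.
have symD := @sym_defect_kernel n.
(* D (u - 2 v) >= 0 is the inequality D (u) <= 2 D (u - v) + 2 D (v). *)
have Duv := form_defect_ge0 n (bmfD bu (bmfZ (-2) bv)).
have DK := form_defect_le n (bmfD bu (bmfZ (-1) bv)).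
have Dv : form mu (defect_kernel n) v v <= e / 8.
  rewrite -(ler_pM2l n0) (le_trans (form_defect_rate n bv))// (le_trans _ nc)//.
  by rewrite ler_wpM2l// /v inner_ball_average// lef_pV2 ?posrE// ball_mass_gt0.
rewrite (form_square_add mu (-2) (bmf_defect_kernel n) symD bu bv) in Duv.
rewrite (form_square_add mu (-1) (bmf_defect_kernel n) symD bu bv) in DK.
rewrite (form_square_add mu (-1) bK symK bu bv) in DK.
have Dx : `|form mu (defect_kernel n) u u - defect_kernel n (x, x)| <= e / 4 :=
  dP x x r r rd rd.
have Ku : `|form mu K u u - K (x, x)| <= e / 16 := sP x x r r rs rs.
have Kuv : `|form mu K u v - K (x, x)| <= e / 16 := sP x x r s rs ss.
have Kv : `|form mu K v v - K (x, x)| <= e / 16 := sP x x s s ss ss.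
move: Duv DK Dv Dx Ku Kuv Kv.
generalize (form mu (defect_kernel n) u u) (form mu (defect_kernel n) u v)
  (form mu (defect_kernel n) v v) (form mu K u u) (form mu K u v) (form mu K v v)
  (defect_kernel n (x, x)) (K (x, x)).
move=> a b c' ka kb kc D k Duv DK Dv; rewrite !ler_norml.
by move=> /andP[? ?] /andP[? ?] /andP[? ?] /andP[? ?]; lra.
Qed.

End sqrt_kernels.

(** * Limits of rapidly converging kernels *)

Section limit_kernel.
Context {R : realType} d (T : measurableType d) (mu : probability T R).

Lemma square_integrable_Lfun2 d' (T' : measurableType d')
    (m : {measure set T' -> \bar R}) (f : T' -> R) :
  measurable_fun [set: T'] f -> (\int[m]_x (f x ^+ 2)%:E < +oo)%E ->
  f \in Lfun m 2%:E.
Proof.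
move=> mf f2; rewrite inE /=; apply/andP; split; first by rewrite inE.
rewrite inE /= /finite_norm unlock poweR_lty//.
rewrite (_ : integral _ _ _ = (\int[m]_x (f x ^+ 2)%:E)%E)//.
apply: eq_integral => x _ /=.
by rewrite powR_mulrn// real_normK// num_real.
Qed.

Variables (k : nat -> T * T -> R) (K : T * T -> R).
Hypotheses (bk : forall n, bmf (k n)) (k0 : forall p, k 0 p = 0).
Hypothesis symk : forall n x y, k n (x, y) = k n (y, x).

Let dk n p : R := k n.+1 p - k n p.

Hypothesis dk_small : forall n x, \int[mu]_z (dk n (x, z) ^+ 2) <= 2 * 4^-1 ^+ n.

Let bdk2 n : bmf (fun p => dk n p ^+ 2).
Proof.
apply: (@eq_bmf _ _ _ (fun p => dk n p * dk n p)) => [p|]; first by rewrite expr2.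
by apply: bmfM; exact: bmfB.
Qed.

Let Q n p : R := \sum_(i < n) 2 ^+ i * dk i p ^+ 2.

(* The function H is symmetric, has integrable sections, and dominates, up
   to a factor 2, the squares of all the kernels; where it is finite, they converge. *)
Let H p : \bar R := (\sum_(0 <= i <oo) (2 ^+ i * dk i p ^+ 2)%:E)%E.

Let Q_le_H n p : ((Q n p)%:E <= H p)%E.
Proof.
rewrite /Q -sumEFin -(big_mkord xpredT (fun i => (2 ^+ i * dk i p ^+ 2)%:E)).
by apply: nneseries_lim_ge => i _ _; rewrite lee_fin mulr_ge0 ?sqr_ge0// exprn_ge0.
Qed.

Let geo_half n : \sum_(i < n) 2^-1 ^+ i = 2 - 2 * 2^-1 ^+ n :> R.
Proof.
elim: n => [|n IH]; first by rewrite big_ord0 expr0 mulr1 subrr.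
by rewrite big_ord_recr /= IH exprS; field.
Qed.

Let geo_half_le2 n : \sum_(i < n) 2^-1 ^+ i <= 2 :> R.
Proof. by rewrite geo_half lerBlDr lerDl mulr_ge0// exprn_ge0// invr_ge0. Qed.

(** Cauchy-Schwarz for the telescoping sum k n = \sum_(i < n) dk i, with weights
    2^-i. *)
Let k_sqr_le_Q n p : k n p ^+ 2 <= 2 * Q n p.
Proof.
have H1 : k n p ^+ 2 <= (\sum_(i < n) 2^-1 ^+ i) * Q n p.
  elim: n => [|n IH]; first by rewrite k0 expr0n /Q !big_ord0 mul0r.
  rewrite (_ : k n.+1 p = k n p + dk n p); last by rewrite /dk addrC subrK.
  rewrite /Q !big_ord_recr /= -/(Q n p).
  have Q0 : 0 <= Q n p.
    by apply: sumr_ge0 => i _; rewrite mulr_ge0 ?sqr_ge0// exprn_ge0.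
  have S0 : 0 <= \sum_(i < n) 2^-1 ^+ i :> R.
    by apply: sumr_ge0 => i _; rewrite exprn_ge0// invr_ge0.
  have e0 : 0 < 2 ^+ n :> R by rewrite exprn_gt0.
  have he : 2^-1 ^+ n = (2 ^+ n)^-1 :> R by rewrite exprVn.
  rewrite he; move: IH Q0 S0 e0.
  move: (k n p) (dk n p) (Q n p) (\sum_(i < n) _) (2 ^+ n) => a b q s e aq q0 s0 e0.
  have key : 2 * a * b <= s * (e * b ^+ 2) + e^-1 * q.
    have X0 : 0 <= s * (e * b ^+ 2) by rewrite mulr_ge0// mulr_ge0 ?sqr_ge0// ltW.
    have Y0 : 0 <= e^-1 * q by rewrite mulr_ge0// invr_ge0 ltW.
    have XY : (a * b) ^+ 2 <= (s * (e * b ^+ 2)) * (e^-1 * q).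
      rewrite [leRHS](_ : _ = (s * q) * b ^+ 2); last by field; rewrite gt_eqF.
      by rewrite exprMn ler_wpM2r// sqr_ge0.
    rewrite (le_trans (ler_norm _))// -(@ler_pXn2r _ 2) ?nnegrE ?addr_ge0//.
    rewrite real_normK ?num_real//.
    move: XY; move: (s * _) (e^-1 * q) => X Y XY.
    have := sqr_ge0 (X - Y); nra.
  have -> : (s + e^-1) * (q + e * b ^+ 2) =
      s * q + (s * (e * b ^+ 2) + e^-1 * q) + b ^+ 2.
    by field; rewrite gt_eqF.
  by rewrite sqrrD lerD// lerD// -mulr_natl mulrA.
rewrite (le_trans H1)// ler_wpM2r//.
by apply: sumr_ge0 => i _; rewrite mulr_ge0 ?sqr_ge0// exprn_ge0.
Qed.

Let H_ge0 p : (0 <= H p)%E.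
Proof.
by apply: nneseries_ge0 => i _ _; rewrite lee_fin mulr_ge0 ?sqr_ge0// exprn_ge0.
Qed.

Let mH : measurable_fun [set: T * T] H.
Proof.
apply: ge0_emeasurable_sum => [i p _ _|i _].
  by rewrite lee_fin mulr_ge0 ?sqr_ge0// exprn_ge0.
by apply/measurable_EFinP; have [] := bmfZ (2 ^+ i) (bdk2 i).
Qed.

Let symH x y : H (x, y) = H (y, x).
Proof. by apply: eq_eseriesr => i _; rewrite /dk !(symk _ x). Qed.

Let mHx x : measurable_fun [set: T] (fun z => H (x, z)).
Proof.
exact: (measurableT_comp mH
  (measurable_fun_pair (measurable_cst x) (@measurable_id _ T setT))).
Qed.

Let int_H x : (\int[mu]_z H (x, z) <= 4%:E)%E.
Proof.
rewrite integral_nneseries//; last 2 first.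
- move=> i; apply/measurable_EFinP.
  by have [] := bmfZ (2 ^+ i) (bmf_sectr x (bdk2 i)).
- by move=> i z _; rewrite lee_fin mulr_ge0 ?sqr_ge0// exprn_ge0.
apply: lime_le.
  apply: is_cvg_nneseries => i _ _; apply: integral_ge0 => z _.
  by rewrite lee_fin mulr_ge0 ?sqr_ge0// exprn_ge0.
apply: nearW => n /=; rewrite big_mkord.
rewrite (_ : 4%:E = (2 * 2 : R)%:E); last by rewrite -natrM.
apply: (@le_trans _ _ (2 * \sum_(i < n) 2^-1 ^+ i)%:E); last first.
  by rewrite lee_fin ler_wpM2l.
rewrite mulr_sumr -sumEFin; apply: lee_sum => i _.
have b := bmf_sectr x (bdk2 i).
rewrite -(EFin_bRint mu (bmfZ (2 ^+ i) b)) lee_fin bRintZ//.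
apply: (@le_trans _ _ (2 ^+ i * (2 * 4^-1 ^+ i))).
  by rewrite ler_wpM2l// exprn_ge0.
rewrite mulrCA -exprMn (_ : 2 * 4^-1 = 2^-1 :> R)//; by field.
Qed.

Let iH x : mu.-integrable [set: T] (fun z => H (x, z)).
Proof.
apply/integrableP; split; first exact: mHx.
under eq_integral do rewrite gee0_abs//.
exact: le_lt_trans (int_H x) (ltry _).
Qed.

Let aeH x : {ae mu, forall z, (H (x, z) < +oo)%E}.
Proof.
apply: filterS (integrable_ae measurableT (iH x)) => z /(_ I).
by rewrite ge0_fin_numE.
Qed.

(** Testing the finiteness of H, rather than the convergence, makes the symmetry
    and the measurability of the limit immediate. *)
Definition kernel_limit (p : T * T) : R :=
  if (H p < +oo)%E then limn (k ^~ p) else 0.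

Lemma kernel_limit_sym x y : kernel_limit (x, y) = kernel_limit (y, x).
Proof.
rewrite /kernel_limit symH (_ : k ^~ (x, y) = k ^~ (y, x))//.
by apply/funext => n; exact: symk.
Qed.

Let cvg_k p : (H p < +oo)%E -> k ^~ p @ \oo --> kernel_limit p.
Proof.
move=> Hp; rewrite /kernel_limit Hp.
have -> : k ^~ p = series (dk ^~ p).
  apply/funext; elim=> [|n IH]; first by rewrite k0 /series /= big_geq.
  by rewrite /series /= big_nat_recr//= -[X in _ = X + _]IH /dk addrC subrK.
apply: normed_cvg; apply: nondecreasing_is_cvgn.
  by apply: nondecreasing_series => i _ _; exact: normr_ge0.
exists (1 + fine (H p)) => _ [n _ <-].
rewrite /= /series /= big_mkord.
(* Absolute convergence: |u| <= 2^-i / 2 + 2^i u^2. *)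
apply: (@le_trans _ _ (\sum_(i < n) (2^-1 * 2^-1 ^+ i + 2 ^+ i * dk i p ^+ 2))).
  apply: ler_sum => i _; rewrite exprVn -(real_normK (num_real (dk i p))).
  have : 0 < 2 ^+ i :> R by rewrite exprn_gt0.
  move: (2 ^+ i) `|dk i p| => e u e0.
  rewrite -subr_ge0 (_ : _ - _ = e^-1 * ((e * u - 2^-1) ^+ 2 + 4^-1)); last first.
    by field; rewrite gt_eqF.
  by rewrite mulr_ge0// ?invr_ge0 ?ltW// ltr_wpDl// sqr_ge0.
rewrite big_split lerD//=.
  by rewrite -mulr_sumr (le_trans (ler_wpM2l _ (geo_half_le2 n)))// mulVf.
by rewrite -lee_fin fineK ?ge0_fin_numE//; exact: Q_le_H.
Qed.

Lemma measurable_kernel_limit : measurable_fun [set: T * T] kernel_limit.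
Proof.
set D := [set p | (H p < +oo)%E].
have mD : measurable D.
  by rewrite -[D]setTI; exact: emeasurable_fun_infty_o.
apply: (@measurable_fun_cvg _ _ _ _ (fun n p => k n p * \1_D p)) => [n|p _].
  by have [] := bmfM (bk n) (bmf_indic mD).
rewrite indicE; have [Dp|nDp] := boolP (p \in D).
  under eq_fun do rewrite mulr1.
  by apply: cvg_k; move: Dp; rewrite inE.
under eq_fun do rewrite mulr0.
rewrite /kernel_limit ifF; first exact: cvg_cst.
by apply/negP => Hp; move/negP: nDp; apply; rewrite inE.
Qed.

Let kernel_limit_sqr_le p : ((kernel_limit p ^+ 2)%:E <= 2%:E * H p)%E.
Proof.
have [Hp|] := ltP (H p) +oo%E; last first.
  by rewrite leye_eq => /eqP ->; rewrite gt0_muley// leey.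
have c := cvg_k Hp.
have c2 : (fun n => k n p * k n p) @ \oo --> kernel_limit p ^+ 2.
  by rewrite expr2; exact: (cvgM c c).
rewrite -(@fineK _ (H p)) ?ge0_fin_numE// -EFinM lee_fin.
rewrite -(cvg_lim (@Rhausdorff R) c2); apply: limr_le.
  by apply/cvg_ex; eexists; exact: c2.
apply: nearW => n /=; rewrite -expr2 (le_trans (k_sqr_le_Q n p))// ler_wpM2l//.
by rewrite -lee_fin fineK ?ge0_fin_numE.
Qed.

Lemma kernel_limit_sqr_integrable :
  (\int[(mu \x mu)%E]_p (kernel_limit p ^+ 2)%:E < +oo)%E.
Proof.
have le : (\int[(mu \x mu)%E]_p (kernel_limit p ^+ 2)%:E <=
           \int[(mu \x mu)%E]_p (2%:E * H p))%E.
  apply: ge0_le_integral => //.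
  - by move=> p _; rewrite lee_fin sqr_ge0.
  - apply/measurable_EFinP; exact: (measurable_funX 2 measurable_kernel_limit).
  - exact: measurable_funeM.
apply: (le_lt_trans le).
rewrite ge0_integralZl//.
rewrite fubini_tonelli1//; apply: lte_mul_pinfty => //.
apply: (@le_lt_trans _ _ (\int[mu]_x 4%:E)%E); last first.
  rewrite integral_cst//; apply: lte_mul_pinfty => //.
  exact: (fin_num_fun_lty (fin_num_measure mu)).
apply: ge0_le_integral => //.
- by move=> x _; exact: integral_ge0.
- exact: measurable_fun_fubini_tonelli_F.
- by move=> x _; exact: int_H.
Qed.

Hypothesis cvg_square : forall x y,
  (fun n => \int[mu]_z (k n (x, z) * k n (z, y))) @ \oo --> K (x, y).

(** Dominated convergence: the product of the sections of k n at x and at y is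
    below the sum of the sections of H there. *)
Lemma kernel_limit_square x y :
  (K (x, y))%:E = (\int[mu]_z (kernel_limit (x, z) * kernel_limit (z, y))%:E)%E.
Proof.
have mkl x' : measurable_fun [set: T] (fun z => kernel_limit (x', z)).
  exact: (measurableT_comp measurable_kernel_limit
    (measurable_fun_pair (measurable_cst x') (@measurable_id _ T setT))).
have bkk n : bmf (fun z => k n (x, z) * k n (z, y)).
  by apply: bmfM; [exact: bmf_sectr|exact: bmf_sectl].
have [] := @dominated_convergence _ _ _ mu setT measurableT
  (fun n z => (k n (x, z) * k n (z, y))%:E)
  (fun z => (kernel_limit (x, z) * kernel_limit (z, y))%:E)
  (fun z => (H (x, z) + H (y, z))%E).
- by move=> n; apply/measurable_EFinP; have [] := bkk n.
- apply/measurable_EFinP; apply: measurable_funM; first exact: mkl.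
  rewrite (_ : (fun z => kernel_limit (z, y)) = fun z => kernel_limit (y, z))//.
  by apply/funext => z; exact: kernel_limit_sym.
- apply: filterS2 (aeH x) (aeH y) => z Hx Hy _.
  apply/cvg_EFin; first exact: nearW.
  by apply: cvgM; apply: cvg_k; rewrite // symH.
- exact: integrableD.
- apply: nearW => z n _.
  apply: (@le_trans _ _ (Q n (x, z) + Q n (y, z))%:E); last by rewrite EFinD leeD.
  rewrite /= lee_fin (symk n z) normrM.
  have := k_sqr_le_Q n (x, z); have := k_sqr_le_Q n (y, z).
  rewrite -(real_normK (num_real (k n (x, z)))) -(real_normK (num_real (k n (y, z)))).
  by move: `|k n (x, z)| `|k n (y, z)| => a b; have := sqr_ge0 (a - b); nra.
move=> _ _ c; rewrite -(cvg_lim (@ereal_hausdorff R) c).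
apply/esym/cvg_lim; first exact: ereal_hausdorff.
rewrite (_ : [sequence _]_n =
    fun n => (\int[mu]_z (k n (x, z) * k n (z, y)))%:E); last first.
  by apply/funext => n /=; rewrite EFin_bRint.
by apply/cvg_EFin; [exact: nearW|exact: cvg_square].
Qed.

End limit_kernel.

(** * The square root of a positive definite kernel *)

Section square_root.
Context {R : realType} {Omega : pointedMetricType R}.
Hypothesis cptOmega : compact [set: Omega].
Notation B := (borelType Omega).
Variable mu : probability B R.
Hypothesis supp_mu : measure_support mu = [set: Omega].

Lemma contraction_kernel_square_root (K : Omega * Omega -> R) :
  continuous K -> is_symmetric K -> finitely_psd K -> (forall p, `|K p| <= 1) ->
  exists k : B * B -> R, [/\ measurable_fun [set: B * B] k,
    (\int[(mu \x mu)%E]_p (k p ^+ 2)%:E < +oo)%E,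
    is_symmetric k &
    forall x y, (K (x, y))%:E = (\int[mu]_z (k (x, z) * k (z, y))%:E)%E].
Proof.
move=> cK symK psdK K1.
have pow0 j : 0 < 4^-1 ^+ j :> R by rewrite exprn_gt0// invr_gt0.
(* The first kernel of the sequence has to be 0, whose defect K is at most 1. *)
have nuP j : exists n, (forall x, defect_kernel mu K n (x, x) <= 4^-1 ^+ j) /\
    (j = 0%N -> n = 0%N).
  case: j => [|j]; last first.
    have [n nP] :=
      defect_kernel_diag_cvg cptOmega cK symK psdK K1 supp_mu (pow0 j.+1).
    by exists n.
  exists 0%N; split=> // x; rewrite expr0 /defect_kernel /sqrt_square /kernel_comp /=.
  under eq_Rintegral do rewrite mulr0.
  by rewrite Rintegral_cst// mul0r mulr0 addr0 (le_trans (ler_norm _)).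
have [nu nuD] := choice nuP; pose k j := sqrt_kernel mu K (nu j).
have bk j : bmf (k j : B * B -> R).
  by apply: continuous_bmf2 => //; exact: continuous_sqrt_kernel.
have k0 p : k 0%N p = 0 by rewrite /k (nuD 0%N).2.
have symk j x y : k j (x, y) = k j (y, x) by exact: sym_sqrt_kernel.
have dk_small j x : \int[mu]_z ((k j.+1 (x, z) - k j (x, z)) ^+ 2) <= 2 * 4^-1 ^+ j.
  have := difference_kernel_le_diag cptOmega cK symK psdK K1 supp_mu
    (nu j) (nu j.+1) x.
  have -> : kernel_comp mu (difference_kernel mu K (nu j) (nu j.+1))
      (difference_kernel mu K (nu j) (nu j.+1)) (x, x) =
      \int[mu]_z ((k j.+1 (x, z) - k j (x, z)) ^+ 2).
    apply: eq_Rintegral => z _ /=.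
    rewrite /difference_kernel !(sym_sqrt_kernel _ symK _ z).
    by rewrite /k !mulN1r expr2.
  move=> /le_trans; apply.
  have := (nuD j).1 x; have := (nuD j.+1).1 x; rewrite exprS.
  by have := pow0 j; lra.
have cvg_square x y :
    (fun j => \int[mu]_z (k j (x, z) * k j (z, y))) @ \oo --> K (x, y).
  apply/cvgrPdist_le => e e0.
  have : (fun j => 4^-1 ^+ j : R) @ \oo --> (0 : R).
    by apply: cvg_expr; rewrite ger0_norm ?invr_ge0// invf_lt1// ltr1n.
  move=> /cvgrPdist_le/(_ _ e0) c4; apply: filterS c4 => j.
  rewrite sub0r normrN (ger0_norm (ltW (pow0 j))) => je.
  rewrite (_ : _ - _ = defect_kernel mu K (nu j) (x, y)); last first.
    by rewrite /defect_kernel mulN1r.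
  have := defect_kernel_le_diag cptOmega cK symK psdK K1 supp_mu (nu j) x y.
  by have := (nuD j).1 x; have := (nuD j).1 y; lra.
exists (kernel_limit (k : nat -> B * B -> R)); split.
- exact: measurable_kernel_limit.
- exact: kernel_limit_sqr_integrable.
- by move=> x y; exact: kernel_limit_sym.
- by move=> x y; exact: kernel_limit_square.
Qed.

Lemma kernel_square_root (K : Omega * Omega -> R) :
  continuous K -> is_symmetric K -> finitely_psd K ->
  exists k : B * B -> R, [/\ k \in Lfun (mu \x mu)%E 2%:E, is_symmetric k &
    forall x y, (K (x, y))%:E = (\int[mu]_z (k (x, z) * k (z, y))%:E)%E].
Proof.
move=> cK symK psdK; have [M M0 KM] := compact_kernel_bounded cptOmega cK.
(* Scaling by a bound M of K; the square root is multiplied by Num.sqrt M. *)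
have [|||p|k [mk k2 symk kK]] :=
  @contraction_kernel_square_root (fun p => M^-1 * K p).
- by move=> p; apply: cvgM; [exact: cvg_cst|exact: cK].
- by move=> x y; rewrite symK.
- move=> n x c; have := psdK n x c; rewrite -(pmulr_rge0 _ (_ : 0 < M^-1)) ?invr_gt0//.
  congr (0 <= _); rewrite mulr_sumr; apply: eq_bigr => i _.
  by rewrite mulr_sumr; apply: eq_bigr => j _; ring.
- have Mi0 : 0 <= M^-1 by rewrite invr_ge0 ltW.
  by rewrite normrM (ger0_norm Mi0) mulrC ler_pdivrMr// mul1r.
have mkx x : measurable_fun [set: B] (fun z => k (x, z)).
  exact: (measurableT_comp mk
    (measurable_fun_pair (measurable_cst x) (@measurable_id _ B setT))).
have sM : Num.sqrt M ^+ 2 = M by rewrite sqr_sqrtr// ltW.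
exists (fun p => Num.sqrt M * k p); split.
- apply: square_integrable_Lfun2.
    by apply: measurable_funM => //; exact: measurable_cst.
  under eq_integral do rewrite exprMn sM EFinM.
  rewrite ge0_integralZl// ?lte_mul_pinfty// ?lee_fin ?ltW//.
  + by apply/measurable_EFinP; exact: measurable_funX.
  + by move=> p _; rewrite lee_fin sqr_ge0.
- by move=> x y /=; rewrite symk.
- move=> x y; transitivity (M%:E * (M^-1 * K (x, y))%:E)%E.
    by rewrite -EFinM mulrA divff ?mul1r// gt_eqF.
  rewrite kK -integralZl//.
    by apply: eq_integral => z _; rewrite -EFinM -{1}sM; congr EFin; ring.
  exact: (@square_kernel_integrable _ _ _ (fun p => M^-1 * K p) k mk symk kK).
Qed.

End square_root.

(** * Positive definite kernels are squares *)

(* The symmetry of k is needed: on two points of mass 1/2, the antisymmetric k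
   with k (a, b) = 1 represents K = - 1/2 Id, which is not positive definite.
   The integral is extended-real valued and (+oo) - (+oo) is -oo, so equality
   with the finite K (x, y) entails integrability of z |-> k (x, z) k (z, y),
   measurable in z because k is. *)
Theorem proposition2p20 (R : realType) (Omega : pointedMetricType R)
    (cptOmega : compact [set: Omega])
    (mu : probability (borelType Omega) R)
    (supp_mu : measure_support mu = [set: Omega])
    (K : Omega * Omega -> R) (kerK : is_kernel K) :
  positive_definite K <->
  exists k : borelType Omega * borelType Omega -> R,
    [/\ k \in Lfun (mu \x mu)%E 2%:E,
        is_symmetric k &
        forall x y, (K (x, y))%:E = (\int[mu]_z (k (x, z) * k (z, y))%:E)%E].
Proof.
have [cK symK] := kerK; split=> [pdK|[k [Lk symk KE]]].
  by apply: kernel_square_root => //; exact: positive_definite_finitely_psd.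
apply: finitely_psd_positive_definite => //; apply: (square_finitely_psd _ symk KE).
by have := sub_Lfun_mfun Lk; rewrite inE.
Qed.
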